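(* Let $G$ be a finite simple graph and let $T$ be an induced subgraph of $G$ such that $G\setminus T$ is disconnected. Let $C_1,\dots,C_k$ be the connected components of $G\setminus T$, and for $i=1,\dots,k$ let $G_i$ be the induced subgraph of $G$ on the vertex set $V(C_i)\cup V(T)$. Then \[\mathrm{reg}(G)\leq\max\{\mathrm{reg}(G_1),\dots,\mathrm{reg}(G_k),\ \mathrm{reg}(T)+1\}.\]
   Context: All graphs are finite and simple. $G\setminus T$ denotes the induced subgraph of $G$ on $V(G)\setminus V(T)$. Fix a field $F$ of characteristic $0$. For a graph $G$ with vertex set $[n]$, the non-edge ideal is $I(G)=\langle x_ix_j : i\neq j,\ ij\notin E(G)\rangle\subseteq F[x_1,\dots,x_n]$, and $\mathrm{reg}(G):=\max\{r : \beta_{i,i+r}(I(G))\neq 0 \text{ for some } i\}$ is its Castelnuovo-Mumford regularity, where $\beta_{i,j}$ are the graded Betti numbers. If $G$ is complete (so $I(G)=0$), $\mathrm{reg}(G)=1$ by convention; the graph with no vertices is counted as complete. *)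

(* Defs.v *)
From Stdlib Require Import ClassicalEpsilon.
From HB Require Import structures.
From mathcomp Require Import all_boot all_order all_algebra.
From mathcomp Require Import freeg mpoly.

Set Implicit Arguments.
Unset Strict Implicit.
Unset Printing Implicit Defensive.

Import GRing.Theory.
Local Open Scope ring_scope.

Record sgraph := SGraph {
  vertex :> finType;
  edge : rel vertex;
  edge_sym : ssrbool.symmetric edge;
  edge_irr : irreflexive edge
}.

Definition complete (G : sgraph) : bool :=
  [forall x : G, forall y : G, (x != y) ==> edge x y].

Section Induced.
Variables (G : sgraph) (A : {set G}).

Definition induced_edge : rel {x : G | x \in A} :=
  fun x y => edge (val x) (val y).

Lemma induced_sym : ssrbool.symmetric induced_edge.
Proof. by move=> x y; apply: edge_sym. Qed.

Lemma induced_irr : irreflexive induced_edge.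
Proof. by move=> x; apply: edge_irr. Qed.

Definition induced : sgraph := SGraph induced_sym induced_irr.
End Induced.

Definition components (G : sgraph) : {set {set G}} :=
  equivalence_partition (connect (@edge G)) [set: G].

(* The graph with no vertices has no component and is not disconnected. *)
Definition disconnected (G : sgraph) : bool := (1 < #|components G|)%N.

(* Vertex x corresponds to the variable of index [enum_rank x]. *)
Definition nonedge_ideal (F : fieldType) (G : sgraph) :
    {mpoly F[#|G|]} -> Prop :=
  fun p => exists c : G -> G -> {mpoly F[#|G|]},
    p = \sum_(x : G) \sum_(y : G | (x != y) && ~~ edge x y)
          c x y * ('X_(enum_rank x) * 'X_(enum_rank y)).

(* A minimal graded free resolution ... -> F_1 -> F_0 -> I -> 0 by free modules
   of finite rank over S = F[x_1, ..., x_n]. The module F_i is the space of row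
   vectors of length [rk i], its k-th basis vector having degree [shift k], and
   maps act by right multiplication: [diff i] is the matrix of F_(i+1) -> F_i
   and [aug] that of F_0 -> I. Degrees are natural numbers, which is no loss as
   the generators of a minimal resolution of an ideal have degrees >= 0. *)
Record min_graded_free_resolution (F : fieldType) (n : nat)
    (I : {mpoly F[n]} -> Prop) := MinGradedFreeResolution {
  rk : nat -> nat;
  shift : forall i, 'I_(rk i) -> nat;
  diff : forall i, 'M[{mpoly F[n]}]_(rk i.+1, rk i);
  aug : 'cV[{mpoly F[n]}]_(rk 0);
  aug_homog : forall k, aug k 0 \is (shift k).-homog;
  diff_homog : forall i k l, diff i k l != 0 ->
    exists2 e, diff i k l \is e.-homog & (shift k = shift l + e)%N;
  aug_image : forall p, I p <-> exists v : 'rV_(rk 0), (v *m aug) 0 0 = p;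
  aug_exact : forall v : 'rV_(rk 0),
    v *m aug = 0 <-> exists w : 'rV_(rk 1), w *m diff 0 = v;
  diff_exact : forall i (v : 'rV_(rk i.+1)),
    v *m diff i = 0 <-> exists w : 'rV_(rk i.+2), w *m diff i.+1 = v;
  (* the image of F_(i+1) lies in <x_1, ..., x_n> F_i *)
  diff_minimal : forall i k l, (diff i k l)@_0%MM = 0
}.

(* beta_(i,j)(I): the number of basis vectors of degree j in the i-th module of
   a minimal graded free resolution of I (all of them give the same number). *)
Definition graded_betti (F : fieldType) (n : nat) (I : {mpoly F[n]} -> Prop)
    (i j : nat) : nat :=
  epsilon (inhabits 0%N) (fun b => exists R : min_graded_free_resolution I,
    b = #|[set k : 'I_(rk R i) | shift k == j]|).

Definition is_max (P : nat -> Prop) (r : nat) : Prop :=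
  P r /\ forall s, P s -> (s <= r)%N.

Definition reg (F : fieldType) (G : sgraph) : nat :=
  if complete G then 1%N
  else epsilon (inhabits 0%N) (is_max (fun r =>
    exists i, graded_betti (@nonedge_ideal F G) i (i + r) <> 0%N)).

(* Main.v *)
Require Import Defs.
From Stdlib Require Import Classical ClassicalEpsilon FunctionalExtensionality.
From mathcomp Require Import all_boot all_order all_algebra.
From mathcomp Require Import mpoly zify ring.

(** By Hochster's formula, [reg G] is the largest [q + 1] such that, for some
    vertex set [W], the complex of cliques of [G] inside [W] has nonzero reduced
    cohomology on its cliques of size [q]. Since no edge joins two components of
    [G \ T], that complex is the union of the corresponding complexes of the
    [G_i], any two of which meet in that of [T], and the Mayer-Vietoris argument
    gives the bound.

    Hochster's formula is proved through Koszul homology. Along a minimal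
    resolution [F_i] of [I], dimension shifting identifies [H_(i+1)] of the
    Koszul complex of [S/I] with [F_i / m F_i], hence with the basis vectors of
    [F_i]. In multidegree [b], the Koszul complex of [S/I] is the clique complex
    of the support of [b] if [b] is squarefree and is acyclic otherwise. In
    particular it vanishes in degrees above the number of variables, so that, by
    Nakayama's lemma, every syzygy module is finitely generated and a minimal
    resolution exists. *)

Set Implicit Arguments.
Unset Strict Implicit.
Unset Printing Implicit Defensive.

Import GRing.Theory.
Local Open Scope ring_scope.

(** * The Koszul differential *)

Section KoszulDiff.
Variable n : nat.
Implicit Types (v u : 'I_n) (t : {set 'I_n}).

(** The sign that moves e_v to its place in the exterior product of e_v with e_t. *)
Definition ksgn (R : comNzRingType) v t : R :=
  (-1) ^+ #|[set u in t | (u < v)%N]|.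

Lemma ksgnU1 (R : comNzRingType) v u t : v \notin t ->
  ksgn R u (v |: t) = (-1) ^+ (v < u)%N * ksgn R u t.
Proof.
move=> vt; rewrite /ksgn -exprD; congr (_ ^+ _).
have -> : [set w in v |: t | (w < u)%N] =
  (if (v < u)%N then [set v] else set0) :|: [set w in t | (w < u)%N].
  apply/setP=> w; rewrite !inE; case: (eqVneq w v) => [->|wv] /=.
    by case: (v < u)%N; rewrite !inE ?eqxx ?(negPf vt).
  by case: (v < u)%N; rewrite !inE ?(negPf wv).
rewrite cardsU; have [|] := boolP (v < u)%N => vu.
  rewrite cards1 (_ : _ :&: _ = set0) ?cards0 ?subn0 //.
  apply/setP=> w; rewrite !inE; case: eqP => //= ->; by rewrite (negPf vt).
by rewrite set0I cards0 subn0.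
Qed.

Lemma ksgn_sqr (R : comNzRingType) v t : ksgn R v t * ksgn R v t = 1.
Proof. by rewrite /ksgn -expr2 sqrr_sign. Qed.

Section Diff.
Variables (R : comNzRingType) (V : lmodType R) (xi : 'I_n -> R).

(** [c t] is the coefficient of the basis element e_t. Chains of all homological degrees are kept in
    one function: on sets of size p, [kd c] only reads [c] on sets of size p + 1. With [xi] the
    variables this is the Koszul differential, with [xi] equal to 1 the boundary of a simplex. *)
Definition kd (c : {set 'I_n} -> V) t : V :=
  \sum_(v | v \notin t) (ksgn R v t * xi v) *: c (v |: t).

Lemma eq_kd c c' t : (forall t', #|t'| = #|t|.+1 -> c t' = c' t') ->
  kd c t = kd c' t.
Proof.
move=> h; apply: eq_bigr => v vt; rewrite h //.
by rewrite cardsU1 vt.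
Qed.

Lemma kdB c c' t : kd (fun t => c t - c' t) t = kd c t - kd c' t.
Proof. by rewrite -sumrB; apply: eq_bigr => v _; rewrite scalerBr. Qed.

Lemma kd0 t : kd (fun _ => 0) t = 0.
Proof. by rewrite /kd big1 // => v _; rewrite scaler0. Qed.

(** Exchanging the two inserted elements reverses the sign and keeps the coefficient, so the pairs
    with v < u cancel those with u < v. *)
Lemma kd_kd c t : kd (kd c) t = 0.
Proof.
pose G (p : 'I_n * 'I_n) : V :=
  (ksgn R p.1 t * ksgn R p.2 t * (-1) ^+ (p.1 < p.2)%N * (xi p.1 * xi p.2)) *:
     c (p.1 |: (p.2 |: t)).
pose P (p : 'I_n * 'I_n) := [&& p.1 \notin t, p.2 \notin t & p.1 != p.2].
have -> : kd (kd c) t = \sum_(p | P p) G p.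
  rewrite /kd; under eq_bigr => v vt do rewrite scaler_sumr.
  rewrite pair_big_dep /=; apply: eq_big => [[v u]|[v u]] /=.
    rewrite /P /= !inE negb_or.
    by case: (v \notin t); case: (u \notin t); rewrite //= ?andbF // andbT eq_sym.
  rewrite !inE negb_or => /andP[vt /andP[uv ut]].
  rewrite scalerA /G /= ksgnU1 // setUCA; congr (_ *: _).
  by ring.
rewrite (bigID (fun p : 'I_n * 'I_n => p.1 < p.2)%N) /=.
rewrite [X in _ + X](reindex_inj (h := fun p : 'I_n * 'I_n => (p.2, p.1))) /=; last first.
  by move=> [a b] [a' b'] [-> ->].
rewrite [X in _ + X](eq_big (fun p => P p && (p.1 < p.2)%N) (fun p => - G p)).
- by rewrite sumrN subrr.
- move=> [v u]; rewrite /P /= (eq_sym u v) -leqNgt leq_eqVlt.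
  case: (v \notin t) => //=; rewrite ?andbF //; case: (u \notin t) => //=.
  by rewrite -val_eqE /=; case: (eqVneq (v : nat) u).
- move=> [v u] /= /andP[/and3P[_ _ /= nuv] uv]; rewrite /G /= (negPf uv).
  have -> : (v < u)%N by rewrite ltn_neqAle eq_sym nuv leqNgt.
  rewrite -scaleNr setUCA; congr (_ *: _).
  by rewrite expr0 expr1; ring.
Qed.

End Diff.

(** * Contracting homotopy of the simplex *)

Section Toggle.
Variables (F : comNzRingType).
Notation kd1 := (kd (V := F^o) (fun _ => 1)).

(* A contracting homotopy; see [kd_toggle]. *)
Definition toggle v (a : {set 'I_n} -> F^o) t : F^o :=
  if v \in t then ksgn F v (t :\ v) * a (t :\ v) else 0.

Lemma kd_toggle v a t : kd1 (toggle v a) t + toggle v (kd1 a) t = a t.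
Proof.
rewrite {2}/toggle; case: ifPn => vt; last first.
  rewrite addr0 /kd (bigD1 v) //= big1 => [|u /andP[ut uv]].
    rewrite addr0 mulr1 /toggle setU11 setU1K //.
    by rewrite /GRing.scale /= mulrA ksgn_sqr mul1r.
  by rewrite /toggle !inE eq_sym (negPf uv) (negPf vt) /= scaler0.
rewrite /kd [X in _ + _ * X](bigD1 v) /=; last by rewrite !inE eqxx.
rewrite mulrDr /GRing.scale /= mulr1 mulrA ksgn_sqr mul1r setD1K //.
rewrite addrCA mulr_sumr -[RHS]addr0; apply: (congr1 (+%R (a t))).
rewrite [X in _ + X](eq_bigl (fun u => u \notin t)); last first.
  move=> u; rewrite !inE negb_and negbK; case: eqP => [->|_] /=; first by rewrite vt.
  by rewrite andbT.
rewrite -big_split big1 //= => u ut.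
have uv : u != v by apply: contraNneq ut => ->.
rewrite /toggle !inE vt orbT.
have -> : (u |: t) :\ v = u |: (t :\ v).
  apply/setP=> w; rewrite !inE; case: (eqVneq w u) => [->|//]; rewrite uv //.
rewrite ksgnU1 ?inE ?(negPf ut) ?andbF //.
have -> : ksgn F u t = (-1) ^+ (v < u)%N * ksgn F u (t :\ v).
  by rewrite -{1}(setD1K vt) ksgnU1 // !inE eqxx.
have : ((v < u) + (u < v) = 1)%N.
  by move: uv; rewrite -val_eqE /=; case: ltngtP.
case: (v < u)%N; case: (u < v)%N => //= _; rewrite ?expr0 ?expr1; ring.
Qed.

(** Relative form of [kd_toggle]: cycles are tested only on a family [A] stable under inserting and
    removing [v], which is how the homotopy passes to quotients. *)
Lemma toggle_exact v (A : pred {set 'I_n}) a p :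
    (forall t, v \notin t -> A (v |: t) = A t) ->
    (forall t, #|t|.+1 = p -> A t -> kd1 a t = 0) ->
  forall t, #|t| = p -> A t -> a t = kd1 (toggle v a) t.
Proof.
move=> hA ha t tp At; rewrite -[LHS](kd_toggle v) [toggle v _ t](_ : _ = 0) ?addr0 //.
rewrite /toggle; case: ifP => // vt; rewrite ha ?mulr0 //.
  by rewrite -tp (cardsD1 v t) vt.
by rewrite -hA ?setD1K // !inE eqxx.
Qed.

End Toggle.
End KoszulDiff.

(** * Multigraded components *)

Lemma dep_choice (A : Type) (B : A -> Type) (P : forall x, B x -> Prop) :
  (forall x, exists y, P x y) -> exists f : forall x, B x, forall x, P x (f x).
Proof.
move=> h; exists (fun x => proj1_sig (constructive_indefinite_description _ (h x))).
by move=> x; case: constructive_indefinite_description.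
Qed.

Section Multidegree.
Variables (F : fieldType) (n : nat).
Notation S := {mpoly F[n]}.
Implicit Types (v : 'I_n) (t : {set 'I_n}) (b m : 'X_{1..n}).

Notation kdX := (kd (V := S^o) (fun v => 'X_v : S)).
Notation kd1 := (kd (V := F^o) (fun _ : 'I_n => 1)).

Definition mset t : 'X_{1..n} := [multinom (v \in t : nat) | v < n].

Lemma msetE t v : mset t v = (v \in t).
Proof. by rewrite mnmE. Qed.

Lemma mdeg_mset t : mdeg (mset t) = #|t|.
Proof.
rewrite mdegE (eq_bigr (fun v => if v \in t then 1 else 0)%N); last first.
  by move=> v _; rewrite msetE; case: ifP.
by rewrite -big_mkcond sum1_card.
Qed.

Lemma msetU1 v t : v \notin t -> mset (v |: t) = (mset t + U_(v))%MM.
Proof.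
move=> vt; apply/mnmP=> u; rewrite mnmDE !msetE mnm1E !inE (eq_sym v).
by case: eqP => [->|]; rewrite ?(negPf vt) ?addn0.
Qed.

Lemma mset_le t b : (mset t <= b)%MM = (t \subset [set v | b v != 0%N]).
Proof.
apply/mnm_lepP/subsetP => h v.
  by move=> vt; have := h v; rewrite inE msetE vt; case: (b v).
by rewrite msetE; case: (boolP (v \in t)) => //= vt; have := h _ vt; rewrite inE; case: (b v).
Qed.

Lemma mcoeffXM v (q : S) m :
  ('X_v * q)@_m = if m v != 0%N then q@_(m - U_(v)) else 0.
Proof.
case: ifPn => mv.
  have hU : (U_(v) <= m)%MM by rewrite lep1mP.
  by rewrite -{1}(submK hU) -(commr_mpolyX U_(v) q) addmC mcoeffMX.
rewrite mcoeffM big1 // => k /eqP mk; rewrite mcoeffX; case: eqP => [e|]; last by rewrite mul0r.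
by case/negP: mv; have := congr1 (fun x : 'X_{1..n} => x v) mk; rewrite -e mnmDE mnm1E eqxx => ->.
Qed.

Lemma toggle_supp v (a : {set 'I_n} -> F^o) b t :
    (forall t, ~~ (mset t <= b)%MM -> a t = 0) -> b v != 0%N ->
  ~~ (mset t <= b)%MM -> toggle v a t = 0.
Proof.
move=> ha bv tb; rewrite /toggle; case: ifP => // vt; rewrite ha ?mulr0 //.
apply: contra tb; rewrite !mset_le => /subsetP h; apply/subsetP=> u ut.
by have [->|uv] := eqVneq u v; [rewrite inE | apply: h; rewrite !inE uv].
Qed.

(* The coefficients of the chain c in multidegree b, the generator indexed by t
   having multidegree [mset t]. *)
Definition mcomp (c : {set 'I_n} -> S) b t : F^o :=
  if (mset t <= b)%MM then (c t)@_(b - mset t) else 0.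

Lemma mcoeff_ksgnM v t (q : S) m : (ksgn S v t * q)@_m = ksgn F v t * q@_m.
Proof.
by rewrite /ksgn -(signr_odd S) -(signr_odd F); case: (odd _); rewrite ?expr0 ?expr1 ?mul1r ?mulN1r // mcoeffN.
Qed.

(** Multiplication by X_v raises the exponent by U_(v), which is also the difference between the
    multidegrees of e_(v |: t) and e_t. In a fixed multidegree the variables thus become the scalar
    1. *)
Lemma mcomp_kd (c : {set 'I_n} -> S^o) b t :
  mcomp (kdX c) b t = kd1 (mcomp c b) t.
Proof.
rewrite /mcomp; case: ifP => [tb|tb]; last first.
  rewrite /kd big1 // => v vt; rewrite [X in _ *: X](_ : _ = 0) ?scaler0 //.
  case: ifP => // /mnm_lepP vtb; case/negP: (negbT tb).
  apply/mnm_lepP=> u; apply: leq_trans (vtb u).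
  by rewrite !msetE !inE; case: (u \in t); rewrite ?orbT.
rewrite raddf_sum; apply: eq_bigr => v vt /=.
rewrite /GRing.scale /= mulr1 -mulrA mcoeff_ksgnM; congr (_ * _).
rewrite mcoeffXM msetU1 //.
have -> : (mset t + U_(v) <= b)%MM = ((b - mset t)%MM v != 0%N).
  rewrite -lep1mP; apply/mnm_lepP/mnm_lepP => h u; have := h u;
    have := mnm_lepP tb u; rewrite mnmDE mnmBE; lia.
by rewrite submDA.
Qed.

Lemma mcompB (c d : {set 'I_n} -> S) b t :
  mcomp (fun t => c t - d t) b t = mcomp c b t - mcomp d b t.
Proof. by rewrite /mcomp; case: ifP; rewrite ?subr0 // mcoeffB. Qed.

(** The cutoff [B] is there because a chain of polynomials has only finitely many nonzero
    multigraded components. *)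
Lemma exists_mcomp (B : nat) (e : 'X_{1..n} -> {set 'I_n} -> F) :
    (forall b t, ~~ (mset t <= b)%MM -> e b t = 0) ->
  exists d : {set 'I_n} -> S,
    forall b t, mcomp d b t = if (mdeg b < B)%N then e b t else 0.
Proof.
move=> he; exists (fun t => \sum_(b : 'X_{1..n < B} | (mset t <= b)%MM)
  e b t *: 'X_[b - mset t]) => b t.
rewrite /mcomp; case: ifPn => [tb|/he ->]; last by case: ifP.
rewrite raddf_sum /=; case: ifPn => [bB|bB].
  rewrite (bigD1 (BMultinom bB)) //= mcoeffZ mcoeffX eqxx mulr1 big1 ?addr0 //.
  move=> b' /andP[tb' nb]; rewrite mcoeffZ mcoeffX; case: eqP => [E|]; last by rewrite mulr0.
  case/eqP: nb; apply: val_inj => /=.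
  by rewrite -(submK tb') E submK.
rewrite big1 // => b' tb'; rewrite mcoeffZ mcoeffX; case: eqP => [E|]; last by rewrite mulr0.
by case/negP: bB; rewrite -(submK tb) -E (submK tb') bmdeg.
Qed.

(** Glues boundaries found in each multidegree. The monomials satisfying [Q] are those ignored, in
    applications the monomials of an ideal. *)
Lemma boundary_of_mcomp (Q : pred 'X_{1..n}) (c : {set 'I_n} -> S^o) p :
    (forall b, exists e : {set 'I_n} -> F^o,
       (forall t, ~~ (mset t <= b)%MM -> e t = 0) /\
       forall t, #|t| = p -> (mset t <= b)%MM -> ~~ Q (b - mset t)%MM ->
         mcomp c b t = kd1 e t) ->
  exists d : {set 'I_n} -> S^o,
    forall t, #|t| = p -> forall m, ~~ Q m -> (c t - kdX d t)@_m = 0.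
Proof.
case/dep_choice => e he.
(* Since e_t has degree at most n, every component of [c] in degree at least [B] vanishes, and there
   zero is a valid primitive. *)
pose B := (\max_(t : {set 'I_n}) msize (c t) + n.+1)%N.
have [|d hd] := @exists_mcomp B e; first by move=> b t; have [h _] := he b; apply: h.
exists d => t tp m Qm.
pose b := (m + mset t)%MM.
have bm : (b - mset t)%MM = m by rewrite addmK.
have tb : (mset t <= b)%MM by rewrite lem_addl.
have -> : (c t - kdX d t)@_m = mcomp (fun t => c t - kdX d t) b t.
  by rewrite /mcomp tb bm.
rewrite mcompB mcomp_kd; case: (ltnP (mdeg b) B) => bB.
  have -> : kd1 (mcomp d b) t = kd1 (e b) t.
    by apply: eq_kd => t' _; rewrite hd bB.
  by rewrite (he b).2 ?bm // subrr.
have -> : kd1 (mcomp d b) t = kd1 (fun _ => 0) t.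
  by apply: eq_kd => t' _; rewrite hd ltnNge bB.
rewrite kd0 subr0 /mcomp tb bm; apply: memN_msupp_eq0; apply: msize_mdeg_ge.
have : (msize (c t) <= \max_(t : {set 'I_n}) msize (c t))%N by exact: leq_bigmax.
have : (#|t| <= n)%N by rewrite -[X in (_ <= X)%N]card_ord max_card.
by move: bB; rewrite mdegD mdeg_mset /B; lia.
Qed.

(** In a nonzero multidegree, toggling a variable of its support contracts the complex. Multidegree
    zero only involves the empty set, where the constant term is excluded by hypothesis. *)
Lemma koszul_exact (c : {set 'I_n} -> S^o) p :
    (forall t, #|t|.+1 = p -> kdX c t = 0) -> (p = 0%N -> (c set0)@_0%MM = 0) ->
  exists d : {set 'I_n} -> S^o, forall t, #|t| = p -> c t = kdX d t.
Proof.
move=> hc h0; have [|d hd] := @boundary_of_mcomp xpred0 c p; last first.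
  by exists d => t tp; apply/eqP; rewrite -subr_eq0; apply/eqP/mpolyP=> m; rewrite hd // mcoeff0.
move=> b; have [/existsP[v bv]|/existsPn b0] := boolP [exists v, b v != 0%N].
  exists (toggle v (mcomp c b)); split=> [t|t tp _ _].
    by apply: toggle_supp => // s sb; rewrite /mcomp (negPf sb).
  apply: (toggle_exact (A := predT) (p := p)) => // s sp _; rewrite -mcomp_kd /mcomp hc //.
  by rewrite mcoeff0 if_same.
have -> : b = 0%MM by apply/mnmP=> v; rewrite mnm0E; have /negPn/eqP := b0 v.
exists (fun _ => 0); split=> // t tp t0 _; rewrite kd0.
have te : t = set0.
  by apply/eqP; rewrite -subset0; apply: subset_trans (_ : [set v | 0%MM v != 0%N] \subset _);
     rewrite -?mset_le //; apply/subsetP=> v; rewrite inE mnm0E.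
rewrite /mcomp; case: ifP => // _; rewrite te.
have -> : mset set0 = 0%MM by apply/mnmP=> v; rewrite msetE mnm0E inE.
by rewrite subm0 h0 // -tp te cards0.
Qed.

End Multidegree.

(** * Dimension shifting *)

Section GradedModules.
Variables (F : fieldType) (n : nat).
Notation S := {mpoly F[n]}.
Implicit Types (t : {set 'I_n}).

(** The part of [p] that contributes degree [d] when [p] multiplies a basis vector of degree [k];
    the test guards against truncated subtraction. *)
Definition hcomp (d k : nat) (p : S) : S :=
  if (k <= d)%N then pihomog mdeg (d - k) p else 0.

Lemma mcoeff_pihomog d (p : S) m :
  (pihomog mdeg d p)@_m = if mdeg m == d then p@_m else 0.
Proof.
rewrite pihomogE [in RHS](mpolyE p) !raddf_sum /= big_mkcond -mulrb -sumrMnl.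
apply: eq_bigr => k _; rewrite mcoeffZ mcoeffX mulrb.
by case: (eqVneq k m) => [->|ne] //; rewrite mulr0 !if_same.
Qed.

Lemma mcoeff_hcomp d k (p : S) m :
  (hcomp d k p)@_m = if (mdeg m + k == d)%N then p@_m else 0.
Proof.
rewrite /hcomp; case: leqP => kd; last by rewrite mcoeff0 ifF //; apply/eqP; lia.
rewrite mcoeff_pihomog; congr (if _ then _ else _); lia.
Qed.

Lemma hcompM d k e (p q : S) : q \is e.-homog ->
  hcomp d k (p * q) = hcomp d (k + e) p * q.
Proof.
move=> hq; apply/mpolyP=> m; rewrite mcoeff_hcomp !mcoeffM.
rewrite -mulrb -sumrMnl; apply: eq_bigr => i /eqP mi; rewrite mcoeff_hcomp.
have [qe|qe] := eqVneq (mdeg i.2) e; last first.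
  by rewrite (dhomog_nemf_coeff hq qe) !mulr0 mul0rn.
have -> : (mdeg m + k == d)%N = (mdeg i.1 + (k + e) == d)%N.
  by rewrite {1}mi mdegD qe -addnA (addnC e).
by rewrite mulrb; case: ifP; rewrite ?mul0r.
Qed.

Lemma hcompB d k (p q : S) : hcomp d k (p - q) = hcomp d k p - hcomp d k q.
Proof. by apply/mpolyP=> m; rewrite !(mcoeffB, mcoeff_hcomp); case: ifP; rewrite ?subr0. Qed.

Lemma hcompD d k (p q : S) : hcomp d k (p + q) = hcomp d k p + hcomp d k q.
Proof. by apply/mpolyP=> m; rewrite !(mcoeffD, mcoeff_hcomp); case: ifP; rewrite ?addr0. Qed.

Lemma hcomp0 d k : hcomp d k 0 = 0.
Proof. by apply/mpolyP=> m; rewrite !(mcoeff0, mcoeff_hcomp) if_same. Qed.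

Lemma hcomp_sum (I : Type) (r : seq I) (P : pred I) f d k :
  hcomp d k (\sum_(i <- r | P i) f i) = \sum_(i <- r | P i) hcomp d k (f i).
Proof. exact: (big_morph _ (hcompD d k) (hcomp0 d k)). Qed.

Lemma hcomp_id d k (p : S) : hcomp d k (hcomp d k p) = hcomp d k p.
Proof. by apply/mpolyP=> m; rewrite !mcoeff_hcomp; case: (mdeg m + k == d)%N. Qed.

Section Vectors.
Variables (m : nat) (sh : 'I_m -> nat).

(** The component of degree [d], where [k] is an additional shift: the degree of e_t for Koszul
    coefficients, 0 for plain vectors. *)
Definition prj d k (v : 'rV[S]_m) : 'rV[S]_m :=
  \row_l hcomp d (sh l + k) (v 0 l).

Lemma prjB d k u v : prj d k (u - v) = prj d k u - prj d k v.
Proof. by apply/rowP=> l; rewrite !mxE hcompB. Qed.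

Lemma prj0 d k : prj d k 0 = 0.
Proof. by apply/rowP=> l; rewrite !mxE hcomp0. Qed.

Lemma prj_id d k v : prj d k (prj d k v) = prj d k v.
Proof. by apply/rowP=> l; rewrite !mxE hcomp_id. Qed.

Notation kdX := (kd (V := 'rV[S]_m) (fun v => 'X_v : S)).

Lemma homog_ksgnX v t : ksgn S v t * 'X_v \is 1.-homog.
Proof.
have -> : 1%N = (0 + 1)%N by []; apply: dhomogM; last by rewrite dhomogX; apply/eqP; exact: mdeg1.
rewrite /ksgn -signr_odd; case: (odd _); rewrite ?expr0 ?expr1.
  by rewrite rpredN; exact: dhomog1.
exact: dhomog1.
Qed.

Lemma prj_kd (c : {set 'I_n} -> 'rV[S]_m) d t :
  prj d #|t| (kdX c t) = kdX (fun t => prj d #|t| (c t)) t.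
Proof.
apply/rowP=> l; rewrite mxE /kd !summxE hcomp_sum; apply: eq_bigr => v vt.
rewrite !mxE mulrC (hcompM _ _ _ (homog_ksgnX v t)) mulrC.
by rewrite cardsU1 vt addnAC addn1 addnS.
Qed.

Lemma kd_entry (c : {set 'I_n} -> 'rV[S]_m) t l :
  kdX c t 0 l = kd (V := S^o) (fun v => 'X_v : S) (fun t => c t 0 l) t.
Proof. by rewrite /kd summxE; apply: eq_bigr => v vt; rewrite mxE. Qed.

Lemma koszul_exact_row (c : {set 'I_n} -> 'rV[S]_m) p :
    (forall t, #|t|.+1 = p -> kdX c t = 0) ->
    (p = 0%N -> forall l, (c set0 0 l)@_0%MM = 0) ->
  exists d : {set 'I_n} -> 'rV[S]_m, forall t, #|t| = p -> c t = kdX d t.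
Proof.
move=> hc h0.
have [|d hd] := @dep_choice 'I_m (fun=> {set 'I_n} -> S)
  (fun l d => forall t, #|t| = p -> c t 0 l = kd (V := S^o) (fun v => 'X_v : S) d t).
  move=> l; apply: koszul_exact => [t tp|p0]; last exact: h0.
  by rewrite -kd_entry hc // mxE.
exists (fun t => \row_l d l t) => t tp; apply/rowP=> l.
by rewrite kd_entry hd //; apply: (eq_kd (V := S^o)) => t' _; rewrite mxE.
Qed.

(* H_p of the Koszul complex of S^m/N is nonzero in degree j. Chains are
   functions on all subsets of the variables with values in S^m; only the sets
   of the relevant cardinality are tested, and only modulo N. *)
Definition koszul_nz (N : 'rV[S]_m -> Prop) (p j : nat) : Prop :=
  exists c : {set 'I_n} -> 'rV[S]_m,
    [/\ forall t, prj j #|t| (c t) = c t,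
        forall t, #|t|.+1 = p -> N (kdX c t)
      & ~ exists d : {set 'I_n} -> 'rV[S]_m,
            forall t, #|t| = p -> N (c t - kdX d t)].

Lemma koszul_nz_ext N N' p j : (forall v, N v <-> N' v) ->
  koszul_nz N p j -> koszul_nz N' p j.
Proof.
move=> e [c [h1 h2 h3]]; exists c; split=> // [t /h2 /e //|[d hd]].
by apply: h3; exists d => t /hd /e.
Qed.

End Vectors.

Definition graded_mx r m (sh' : 'I_r -> nat) (sh : 'I_m -> nat) (D : 'M[S]_(r, m)) :=
  forall i l, D i l != 0 -> exists2 e, D i l \is e.-homog & sh' i = (sh l + e)%N.

Definition in_max r m (D : 'M[S]_(r, m)) := forall i l, (D i l)@_0%MM = 0.

Lemma in_maxM q r m (u : 'M[S]_(q, r)) (D : 'M[S]_(r, m)) :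
  in_max D -> in_max (u *m D).
Proof.
move=> hD i l; rewrite mxE raddf_sum big1 // => k _.
by rewrite /= rmorphM /= hD mulr0.
Qed.

Section Step.
Variables (r m : nat) (sh' : 'I_r -> nat) (sh : 'I_m -> nat) (D : 'M[S]_(r, m)).
Hypothesis hD : graded_mx sh' sh D.

Notation kdX := (kd (fun v => 'X_v : S)).

Lemma prj_mul d k u : prj sh d k (u *m D) = prj sh' d k u *m D.
Proof.
apply/rowP=> l; rewrite !mxE hcomp_sum; apply: eq_bigr => i _; rewrite mxE.
have [->|/hD[e he ->]] := eqVneq (D i l) 0; first by rewrite !mulr0 hcomp0.
by rewrite (hcompM _ _ _ he) addnAC.
Qed.

Lemma kd_mul (c : {set 'I_n} -> 'rV[S]_r) t :
  kdX (fun t => c t *m D) t = kdX c t *m D.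
Proof. by rewrite /kd mulmx_suml; apply: eq_bigr => v _; rewrite scalemxAl. Qed.

Definition im_mx (v : 'rV[S]_m) := exists w : 'rV_r, w *m D = v.
Definition ker_mx (v : 'rV[S]_r) := v *m D = 0.

Lemma choose_lift (c : {set 'I_n} -> 'rV[S]_m) p :
    (forall t, #|t| = p -> im_mx (c t)) ->
  exists u : {set 'I_n} -> 'rV[S]_r, forall t, #|t| = p -> u t *m D = c t.
Proof.
move=> h; apply: (@dep_choice {set 'I_n} (fun=> 'rV[S]_r)
  (fun t u => #|t| = p -> u *m D = c t)) => t.
have [tp|tp] := eqVneq #|t| p; first by have [w hw] := h t tp; exists w.
by exists 0 => e; rewrite e eqxx in tp.
Qed.

(** This is injectivity of the connecting map from H_(p+1) of S^m / im D to H_p of S^r / ker D: the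
    boundary of [c] is lifted through [D], and the lift is projected back to degree [j]. *)
Lemma koszul_nz_down p j : koszul_nz sh im_mx p.+1 j -> koszul_nz sh' ker_mx p j.
Proof.
move=> [c [hc cyc nb]].
have [|u0 hu0] := @choose_lift (kdX c) p; first by move=> t tp; apply: cyc; rewrite tp.
pose u t := prj sh' j #|t| (u0 t).
have hu t : #|t| = p -> u t *m D = kdX c t.
  by move=> tp; rewrite -prj_mul hu0 // prj_kd; apply: eq_kd => t' _; rewrite hc.
exists u; split.
- by move=> t; rewrite prj_id.
- move=> t tp; rewrite /ker_mx -kd_mul -[RHS](kd_kd (fun v => 'X_v : S) c t).
  by apply: eq_kd => t' e; rewrite hu // e.
move=> [w hw]; apply: nb.
(* If the lift bounds [w] modulo the kernel, then [c] corrected by [w *m D] is a true cycle of S^m,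
   hence a boundary. *)
have [||d hd] := @koszul_exact_row _ (fun t => c t - w t *m D) p.+1.
- move=> t [tp]; rewrite kdB kd_mul -hu //.
  by apply/eqP; rewrite -mulmxBl; apply/eqP; exact: hw.
- by [].
exists d => t tp; exists (w t); rewrite -hd // opprB addrC subrK //.
Qed.

(** Surjectivity of the connecting map: [u *m D] is a cycle of S^m, so it bounds some [c]. For
    [p = 0] this needs the constant terms to vanish, as H_0 of S^m is not zero. *)
Lemma koszul_nz_up p j : (p = 0%N -> in_max D) ->
  koszul_nz sh' ker_mx p j -> koszul_nz sh im_mx p.+1 j.
Proof.
move=> h0 [u [hu cyc nb]].
have [||c0 hc0] := @koszul_exact_row _ (fun t => u t *m D) p.
- by move=> t tp; rewrite kd_mul; exact: cyc.
- by move=> /h0 hD0 l; exact: in_maxM.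
pose c t := prj sh j #|t| (c0 t).
have hc t : #|t| = p -> u t *m D = kdX c t.
  by move=> tp; rewrite -prj_kd -hc0 // prj_mul hu.
exists c; split.
- by move=> t; rewrite prj_id.
- by move=> t [tp]; exists (u t); exact: hc.
move=> [e /choose_lift[w hw]]; apply: nb; exists w => t tp.
rewrite /ker_mx mulmxBl hc // -kd_mul.
rewrite [X in _ - X](@eq_kd _ _ _ _ _ (fun t => c t - kdX e t)) => [|t' e'].
  by rewrite kdB kd_kd subr0 subrr.
by rewrite hw // e' tp.
Qed.

End Step.
End GradedModules.

(** * Betti numbers and generation of graded submodules *)

Lemma least_nat (P : nat -> Prop) m : P m ->
  exists2 r, P r & forall r', P r' -> (r <= r')%N.
Proof.
elim: m {-2}m (leqnn m) => [|N IH] m mN Pm.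
  by exists m => // r' _; move: mN; rewrite leqn0 => /eqP->.
case: (excluded_middle_informative (exists2 r', P r' & (r' < m)%N)) => [[r' Pr' r'm]|no].
  by apply: (IH r') => //; lia.
by exists m => // r' Pr'; rewrite leqNgt; apply/negP=> h; case: no; exists r'.
Qed.

Section Resolutions.
Variables (F : fieldType) (n : nat).
Notation S := {mpoly F[n]}.
Notation kdX := (kd (fun v => 'X_v : S)).

Lemma mcoeff0_kd m (c : {set 'I_n} -> 'rV[S]_m) t l : (kdX c t 0 l)@_0%MM = 0.
Proof.
rewrite /kd summxE raddf_sum big1 // => v _; rewrite mxE /= -mulrA mcoeff_ksgnM.
by rewrite mcoeffXM mnm0E eqxx mulr0.
Qed.

(** When [N] lies in m S^m, H_0 of S^m / N is S^m / m S^m, with the standard basis vectors as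
    basis. *)
Lemma koszul_nz0 m (sh : 'I_m -> nat) (N : 'rV[S]_m -> Prop) j :
    N 0 -> (forall v, N v -> in_max v) ->
  koszul_nz sh N 0 j <-> exists k, sh k = j.
Proof.
move=> N0 Nmax; split=> [[c [hc _ nb]]|[k kj]].
  case: (excluded_middle_informative (exists k, sh k = j)) => // nok; case: nb.
  have [||d hd] := @koszul_exact_row _ _ _ c 0; last 1 first.
  - by exists d => t tp; rewrite -hd // subrr.
  - by [].
  - move=> _ l; rewrite -hc mxE mcoeff_hcomp mdeg0 cards0 addn0.
    by case: eqP => // e; case: nok; exists l.
exists (fun t => if t == set0 then delta_mx 0 k else 0); split=> //.
  move=> t; case: eqP => [->|_]; last exact: prj0.
  apply/rowP=> l; rewrite !mxE cards0 addn0 eqxx /=; apply/mpolyP=> u.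
  rewrite mcoeff_hcomp; case: eqP => // ne; case: eqP => [e|_]; last by rewrite mcoeff0.
  rewrite mcoeff1; case: eqP => // u0; case: ne; rewrite u0 mdeg0 e; exact: kj.
case=> d /(_ set0); rewrite cards0 eqxx => /(_ erefl) /Nmax /(_ 0 k).
rewrite !mxE mcoeffB mcoeff0_kd !eqxx mcoeff1 eqxx subr0 => /eqP.
by rewrite oner_eq0.
Qed.

(** * Betti numbers as Koszul homology *)

Section FromResolution.
Variables (I : S -> Prop) (R : min_graded_free_resolution I).
Hypothesis Imax : forall p, I p -> p@_0%MM = 0.

(** The kernel of the map leaving F_i; for [i = 0] that map is the augmentation into S, viewed as
    row vectors of length 1. *)
Definition res_ker i : 'rV[S]_(rk R i) -> Prop :=
  if i is i'.+1 return 'rV[S]_(rk R i) -> Prop then ker_mx (diff R i')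
  else ker_mx (aug R).

Notation shI := (fun _ : 'I_1 => 0%N).
Notation idl := (fun v : 'rV[S]_1 => I (v 0 0)).

Lemma graded_aug : graded_mx (@shift _ _ _ R 0) shI (aug R).
Proof. by move=> i l _; rewrite (ord1 l); exists (shift i) => //; exact: aug_homog. Qed.

Lemma graded_diff i : graded_mx (@shift _ _ _ R i.+1) (@shift _ _ _ R i) (diff R i).
Proof. exact: diff_homog. Qed.

Lemma res_kerE i v : res_ker v <-> im_mx (diff R i) v.
Proof. by case: i v => [|i] v; [exact: aug_exact | exact: diff_exact]. Qed.

Lemma im_aug v : im_mx (aug R) v <-> idl v.
Proof.
split=> [[w <-]|/(aug_image R)[w hw]]; first by apply/(aug_image R); exists w.
by exists w; apply/matrixP=> a k; rewrite (ord1 a) (ord1 k).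
Qed.

Lemma in_max_aug : in_max (aug R).
Proof.
move=> i l; rewrite (ord1 l); apply: Imax; apply/(aug_image R).
by exists (delta_mx 0 i); rewrite -rowE mxE.
Qed.

(** Each map of the resolution lowers the homological degree by one through the connecting
    isomorphism, exactness identifying each kernel with the next image. *)
Lemma koszul_nz_res i p j :
  koszul_nz shI idl (p + i.+1) j <-> koszul_nz (@shift _ _ _ R i) (@res_ker i) p j.
Proof.
elim: i p => [|i IH] p.
  rewrite addn1; split=> h.
    apply: (koszul_nz_down graded_aug); apply: koszul_nz_ext h => v.
    by split=> /im_aug.
  apply: (koszul_nz_ext (N := im_mx (aug R))); first by move=> v; exact: im_aug.
  by apply: (koszul_nz_up graded_aug) => // _; exact: in_max_aug.
rewrite addnS -addSn; split=> [/IH h|h].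
  apply: (koszul_nz_down (@graded_diff i)); apply: koszul_nz_ext h => v.
  exact: res_kerE.
apply/IH; apply: (koszul_nz_ext (N := im_mx (diff R i))).
  by move=> v; split=> /res_kerE.
apply: (koszul_nz_up (@graded_diff i)) => // _ k l; exact: diff_minimal.
Qed.

(** Case [p = 0] of [koszul_nz_res]: by minimality the kernel lies in m F_i, so [koszul_nz0] reads
    off the degrees of the basis vectors. The right-hand side does not mention [R]. *)
Lemma betti_koszul i j :
  #|[set k : 'I_(rk R i) | shift k == j]| <> 0%N <-> koszul_nz shI idl i.+1 j.
Proof.
have -> : i.+1 = (0 + i.+1)%N by [].
rewrite koszul_nz_res koszul_nz0.
- split=> [/eqP|[k kj]]; last first.
    by apply/eqP; rewrite -lt0n; apply/card_gt0P; exists k; rewrite inE kj.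
  by rewrite -lt0n => /card_gt0P[k]; rewrite inE => /eqP kj; exists k.
- by apply/res_kerE; exists 0; rewrite mul0mx.
- move=> v /res_kerE[w <-]; apply: in_maxM => k l; exact: diff_minimal.
Qed.

End FromResolution.

(** * Generators of graded submodules *)

Definition graded_submod m (sh : 'I_m -> nat) (N : 'rV[S]_m -> Prop) :=
  [/\ N 0, forall u v, N u -> N v -> N (u + v), forall a v, N v -> N (a *: v)
    & forall d k v, N v -> N (prj sh d k v)].

Lemma graded_submod_sum m (sh : 'I_m -> nat) N (K : Type) (r : seq K) (P : pred K) f :
  graded_submod sh N -> (forall i, N (f i)) -> N (\sum_(i <- r | P i) f i).
Proof. by case=> N0 ND _ _ Nf; elim/big_rec: _ => // i v _; exact: ND. Qed.

Lemma prj_partition m (sh : 'I_m -> nat) (v : 'rV[S]_m) :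
  exists D, v = \sum_(d < D) prj sh d 0 v.
Proof.
exists (\max_l (sh l + msize (v 0%R l)).+1)%N; apply/rowP=> l; rewrite summxE.
apply/mpolyP=> u; rewrite raddf_sum /=.
under eq_bigr => d _ do rewrite mxE addn0 mcoeff_hcomp.
have [uv|uv] := boolP (u \in msupp (v 0 l)); last first.
  by rewrite (memN_msupp_eq0 uv) big1 // => d _; rewrite if_same.
have lt : (mdeg u + sh l < \max_l (sh l + msize (v 0%R l)).+1)%N.
  apply: leq_trans (leq_bigmax l) => /=; have := msize_mdeg_lt uv; lia.
rewrite (bigD1 (Ordinal lt)) //= eqxx big1 ?addr0 // => d.
by rewrite -val_eqE /= eq_sym => /negPf->.
Qed.

(** Write [v] as the boundary of a 1-chain [f]. Then [f] is a cycle modulo [N], so by vanishing of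
    H_1 it can be corrected by a boundary to take values in [N]; its own boundary is still [v]. *)
Lemma decomp_of_koszul m (sh : 'I_m -> nat) N j v :
    graded_submod sh N -> (forall v, N v -> in_max v) -> ~ koszul_nz sh N 1 j ->
    N v -> prj sh j 0 v = v ->
  exists2 y : 'I_n -> 'rV[S]_m, forall i, N (y i) & v = \sum_i 'X_i *: y i.
Proof.
move=> gN Nmax nz Nv hv.
have [||c hc] := @koszul_exact_row _ _ _ (fun _ => v) 0 => //.
  by move=> _ l; exact: Nmax.
pose f (t : {set 'I_n}) := prj sh j #|t| (c t).
have hf : v = kdX f set0.
  have := prj_kd sh c j set0; rewrite cards0 -hc ?cards0 // hv; exact.
case: (excluded_middle_informative (exists d : {set 'I_n} -> 'rV[S]_m,
    forall t : {set 'I_n}, #|t| = 1%N -> N (f t - kdX d t))) => [[d hd]|no]; last first.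
  case: nz; exists f; split=> // [t|t [/eqP]]; first by rewrite prj_id.
  by rewrite cards_eq0 => /eqP->; rewrite -hf.
have [_ _ NZ _] := gN.
exists (fun i => ksgn S i set0 *: (f (i |: set0) - kdX d (i |: set0))).
  by move=> i; apply: NZ; apply: hd; rewrite setU0 cards1.
have -> : v = kdX (fun t => f t - kdX d t) set0 by rewrite kdB kd_kd subr0.
apply: eq_big => [i|i _]; first by rewrite inE.
by rewrite scalerA mulrC.
Qed.

(** Graded Nakayama lemma, by induction on the degree: above [B], the coefficients [y i] can be
    replaced by their components one degree lower. *)
Lemma graded_generation m (sh : 'I_m -> nat) (N M : 'rV[S]_m -> Prop) B :
    graded_submod sh N ->
    M 0 -> (forall u v, M u -> M v -> M (u + v)) -> (forall a v, M v -> M (a *: v)) ->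
    (forall j v, (j <= B)%N -> N v -> prj sh j 0 v = v -> M v) ->
    (forall j v, (B < j)%N -> N v -> prj sh j 0 v = v ->
      exists2 y : 'I_n -> 'rV[S]_m, forall i, N (y i) & v = \sum_i 'X_i *: y i) ->
  forall v, N v -> M v.
Proof.
move=> gN M0 MD MZ Mlo Nhi.
have [_ _ _ Np] := gN.
have Msum (K : Type) (r : seq K) (P : pred K) f :
    (forall i, M (f i)) -> M (\sum_(i <- r | P i) f i).
  by move=> Mf; elim/big_rec: _ => // i v _; exact: MD.
have key j v : N v -> prj sh j 0 v = v -> M v.
  elim/ltn_ind: j v => j IH v Nv hv.
  case: (leqP j B) => [jB|Bj]; first exact: Mlo jB Nv hv.
  have [y Ny ev] := Nhi _ _ Bj Nv hv.
  case: j IH hv Bj => // j IH hv _.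
  have -> : v = \sum_i 'X_i *: prj sh j 0 (y i).
    rewrite -hv ev; apply/rowP=> l; rewrite mxE !summxE hcomp_sum.
    apply: eq_bigr => i _; rewrite !mxE mulrC (@hcompM _ _ _ _ 1); last first.
      by rewrite dhomogX; apply/eqP; exact: mdeg1.
    rewrite mulrC; congr (_ * _); apply/mpolyP=> u; rewrite !mcoeff_hcomp.
    by rewrite addn0 addn1 addnS eqSS.
  apply: Msum => i; apply: MZ; apply: (IH j) => //; first exact: Np.
  by rewrite prj_id.
move=> v Nv; have [D ->] := prj_partition sh v.
by apply: Msum => d; apply: (key d); [exact: Np | exact: prj_id].
Qed.

Section FiniteSpan.
Variables (m : nat) (sh : 'I_m -> nat) (j : nat) (N : 'rV[S]_m -> Prop).
Hypothesis gN : graded_submod sh N.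

(** Coordinates of a vector over F: its coefficients on the monomials of degree at most [j] in each
    entry. They determine a homogeneous vector of degree [j]. *)
Let mons : finType := ('I_m * 'X_{1..n < j.+1})%type.
Let coef (v : 'rV[S]_m) (q : 'I_m * 'X_{1..n < j.+1}) : F := (v 0 q.1)@_(q.2).
Let coefs (v : 'rV[S]_m) : 'rV[F]_#|mons| := \row_(k < #|mons|) coef v (enum_val k).

Let coefs_inj v : prj sh j 0 v = v -> coefs v = 0 -> v = 0.
Proof.
move=> hv h0; apply/rowP=> l; apply/mpolyP=> u; rewrite mxE mcoeff0.
case: (ltnP (mdeg u) j.+1) => uj.
  have := congr1 (fun w : 'rV_#|mons| => w 0 (enum_rank ((l, BMultinom uj) : mons))) h0.
  by rewrite !mxE enum_rankK /coef.
by rewrite -hv mxE mcoeff_hcomp; case: eqP => // e; exfalso; move: e uj; lia.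
Qed.

(** Starting from no rows, append elements of [N] whose coordinates lie outside the span. Each
    raises the rank of the coordinate matrix, which is at most [#|mons|]. *)
Lemma finite_span : exists r (E : 'M[S]_(r, m)),
  (forall i, N (row i E) /\ prj sh j 0 (row i E) = row i E) /\
  forall v, N v -> prj sh j 0 v = v -> im_mx E v.
Proof.
pose good r (E : 'M[S]_(r, m)) := forall i, N (row i E) /\ prj sh j 0 (row i E) = row i E.
pose cf r (E : 'M[S]_(r, m)) : 'M[F]_(r, #|mons|) := \matrix_i coefs (row i E).
have [_ _ NZ _] := gN.
have coefsM r (E : 'M[S]_(r, m)) (w : 'rV[F]_r) :
    coefs (\row_i (w 0 i)%:MP *m E) = w *m cf r E.
  apply/rowP=> k; rewrite !mxE /coef mxE raddf_sum; apply: eq_bigr => i _.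
  by rewrite !mxE /coef mxE /= mcoeffCM.
have goodM r (E : 'M[S]_(r, m)) (w : 'rV[F]_r) : good r E ->
    prj sh j 0 (\row_i (w 0 i)%:MP *m E) = \row_i (w 0 i)%:MP *m E.
  move=> gE; apply/rowP=> l; rewrite mxE [X in hcomp _ _ X]mxE hcomp_sum mxE.
  apply: eq_bigr => i _; rewrite !mxE.
  have := congr1 (fun v : 'rV_m => v 0 l) (gE i).2; rewrite !mxE => {2}<-.
  by apply/mpolyP=> u; rewrite mcoeff_hcomp !mcoeffCM mcoeff_hcomp; case: ifP; rewrite ?mulr0.
have lift r (E : 'M[S]_(r, m)) v : good r E -> prj sh j 0 v = v ->
    (coefs v <= cf r E)%MS -> im_mx E v.
  move=> gE hv /submxP[w hw]; exists (\row_i (w 0 i)%:MP).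
  apply/eqP; rewrite eq_sym -subr_eq0; apply/eqP.
  apply: coefs_inj; first by rewrite prjB hv goodM.
  have -> : coefs (v - \row_i (w 0 i)%:MP *m E) =
      coefs v - coefs (\row_i (w 0 i)%:MP *m E).
    by apply/rowP=> i; rewrite !mxE /coef !mxE mcoeffB.
  by rewrite coefsM hw subrr.
suff H k : forall r (E : 'M[S]_(r, m)), good r E -> (#|mons| <= \rank (cf r E) + k)%N ->
    exists r (E : 'M[S]_(r, m)), good r E /\
      forall v, N v -> prj sh j 0 v = v -> im_mx E v.
  by apply: (H #|mons| 0%N 0); rewrite ?leq_addl // => -[].
elim: k => [|k IH] r E gE hr.
all: case: (excluded_middle_informative (forall v, N v -> prj sh j 0 v = v ->
       (coefs v <= cf r E)%MS)) => [sp|nsp].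
1,3: by exists r, E; split=> // v Nv hv; exact: lift gE hv (sp v Nv hv).
  case: nsp => v _ _; apply: submx_full; rewrite /row_full eqn_leq rank_leq_col /=.
  by rewrite addn0 in hr.
have [v [Nv hv nv]] : exists v, [/\ N v, prj sh j 0 v = v & ~~ (coefs v <= cf r E)%MS].
  case: (excluded_middle_informative
    (exists v, [/\ N v, prj sh j 0 v = v & ~~ (coefs v <= cf r E)%MS])) => // no.
  case: nsp => v Nv hv; apply/negPn/negP=> nv; apply: no; by exists v.
apply: (IH _ (col_mx v E)).
  move=> i; case: (splitP i) => i' ei.
    have -> : i = lshift r i' by apply: val_inj.
    by rewrite (ord1 i') rowKu row_id.
  have -> : i = rshift 1 i' by apply: val_inj.
  by rewrite rowKd; exact: gE.
have -> : cf _ (col_mx v E) = col_mx (coefs v) (cf r E).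
  apply/row_matrixP=> i; rewrite rowK; case: (splitP i) => i' ei.
    have -> : i = lshift r i' by apply: val_inj.
    by rewrite (ord1 i') !rowKu !row_id.
  have -> : i = rshift 1 i' by apply: val_inj.
  by rewrite !rowKd rowK.
apply: leq_trans hr _; rewrite addnS -addSn leq_add2r.
apply: rank_ltmx; rewrite ltmxE.
rewrite -!addsmxE addsmxSr /=; apply: contra nv => h.
exact: submx_trans (addsmxSl _ _) h.
Qed.

End FiniteSpan.
End Resolutions.

(** * Existence of minimal resolutions *)

Section Existence.
Variables (F : fieldType) (n : nat).
Notation S := {mpoly F[n]}.
Notation kdX := (kd (fun v => 'X_v : S)).

Section MinimalGenerators.
Variables (m : nat) (sh : 'I_m -> nat) (N : 'rV[S]_m -> Prop) (B : nat).
Hypothesis gN : graded_submod sh N.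
Hypothesis hiN : forall j v, (B < j)%N -> N v -> prj sh j 0 v = v ->
  exists2 y : 'I_n -> 'rV[S]_m, forall i, N (y i) & v = \sum_i 'X_i *: y i.

Lemma im_mx_sub r (D : 'M[S]_(r, m)) v :
  (forall i, N (row i D)) -> im_mx D v -> N v.
Proof.
move=> hD [w <-]; rewrite mulmx_sum_row; apply: graded_submod_sum gN _ => i.
by have [_ _ NZ _] := gN; apply: NZ.
Qed.

Lemma low_degree_generators b : exists r (sh' : 'I_r -> nat) (D : 'M[S]_(r, m)),
  [/\ graded_mx sh' sh D, forall i, N (row i D)
    & forall j v, (j < b)%N -> N v -> prj sh j 0 v = v -> im_mx D v].
Proof.
elim: b => [|b [r [sh' [D [gD DN hD]]]]].
  by exists 0%N, (fun _ => 0%N), 0; split=> // -[].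
have [q [E [hE spE]]] := finite_span b gN.
exists (r + q)%N, (fun i => if split i is inl k then sh' k else b), (col_mx D E); split.
- move=> i l; case: split_ordP => k ->; rewrite ?col_mxEu ?col_mxEd; first exact: gD.
  have := congr1 (fun v : 'rV_m => v 0 l) (hE k).2; rewrite !mxE addn0 => <-.
  rewrite /hcomp; case: leqP => [lb _|_]; last by rewrite eqxx.
  by exists (b - sh l)%N; [exact: pihomogP | rewrite subnKC].
- by move=> i; case: (split_ordP i) => k ->; rewrite ?rowKu ?rowKd //; exact: (hE k).1.
move=> j v; rewrite ltnS leq_eqVlt => /orP[/eqP->|jb] Nv hv.
  by have [w <-] := spE v Nv hv; exists (row_mx 0 w); rewrite mul_row_col mul0mx add0r.
by have [w <-] := hD j v jb Nv hv; exists (row_mx w 0); rewrite mul_row_col mul0mx addr0.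
Qed.

Lemma finite_generators : exists r (sh' : 'I_r -> nat) (D : 'M[S]_(r, m)),
  graded_mx sh' sh D /\ forall v, N v <-> im_mx D v.
Proof.
have [r [sh' [D [gD DN hD]]]] := low_degree_generators B.+1.
exists r, sh', D; split=> // v; split; last exact: im_mx_sub.
apply: (graded_generation (B := B) gN) => //.
- by exists 0; rewrite mul0mx.
- by move=> _ _ [u <-] [w <-]; exists (u + w); rewrite mulmxDl.
- by move=> a _ [u <-]; exists (a *: u); rewrite scalemxAl.
Qed.

Lemma mcoeff0_eq_prj p : (hcomp 0 0 p : S) = (p@_0%MM)%:MP.
Proof.
apply/mpolyP=> u; rewrite mcoeff_hcomp mcoeffC addn0 mdeg_eq0.
by case: eqP => [->|]; rewrite ?mulr1 ?mulr0.
Qed.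

(* If a relation has a nonzero constant coefficient, its homogeneous component
   in that degree expresses one generator through the others. *)
Lemma minimal_generators : exists r (sh' : 'I_r -> nat) (D : 'M[S]_(r, m)),
  [/\ graded_mx sh' sh D, forall v, N v <-> im_mx D v
    & forall v, ker_mx D v -> in_max v].
Proof.
pose P r := exists (sh' : 'I_r -> nat) (D : 'M[S]_(r, m)),
  graded_mx sh' sh D /\ forall v, N v <-> im_mx D v.
have [r0 hr0] := finite_generators.
have [r [sh' [D [gD hD]]] rmin] := @least_nat P r0 hr0.
exists r, sh', D; split=> // v hv i k; rewrite (ord1 i); apply/eqP/negPn/negP=> nz.
case: r sh' D gD hD rmin v hv k nz => [|r] sh' D gD hD rmin v hv k nz; first by case: k nz.
pose v' := prj sh' (sh' k) 0 v.
have v'D : v' *m D = 0 by rewrite -(prj_mul gD) hv prj0.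
pose a := (v 0 k)@_0%MM.
have v'k : v' 0 k = a%:MP.
  rewrite mxE -mcoeff0_eq_prj; apply/mpolyP=> u; rewrite !mcoeff_hcomp !addn0.
  by rewrite -[X in _ == X]add0n eqn_add2r.
suff /rmin : P r by rewrite ltnn.
exists (fun l => sh' (lift k l)), (row' k D); split=> [l i'|w].
  by rewrite mxE; exact: gD.
have row_lift l : row l (row' k D) = row (lift k l) D by apply/rowP=> i'; rewrite !mxE.
split; last first.
  apply: im_mx_sub => l; rewrite row_lift; apply/hD; exists (delta_mx 0 (lift k l)).
  by rewrite -rowE.
(* Subtracting a multiple of the relation [v'], whose [k]-th coefficient is the nonzero constant
   [a], removes the [k]-th generator from the expression. *)
case/hD => u <-; pose u' := u - (u 0 k * a^-1%:MP) *: v'.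
have u'k : u' 0 k = 0.
  by rewrite mxE [X in _ + X]mxE [X in - X]mxE v'k -mulrA -mpolyCM mulVf // mulr1 subrr.
have -> : u *m D = u' *m D by rewrite mulmxBl -scalemxAl v'D scaler0 subr0.
exists (col' k u'); apply/rowP=> i'; rewrite !mxE (bigD1_ord k) //= u'k mul0r add0r.
by apply: eq_bigr => l _; rewrite !mxE.
Qed.

End MinimalGenerators.

(** The invariant of the construction. The vanishing above degree [n] bounds the degrees of
    generators of [N] and is inherited by the next syzygy module. *)
Definition good_syzygy m (sh : 'I_m -> nat) (N : 'rV[S]_m -> Prop) :=
  [/\ graded_submod sh N, forall v, N v -> in_max v
    & forall p j, (0 < p)%N -> (n < j)%N -> ~ koszul_nz sh N p j].

(** A submodule still to be resolved; a [cover] of it is a minimal system of generators whose kernel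
    is again good, so that the construction can be iterated. *)
Record stage := Stage {
  st_rank : nat;
  st_shift : 'I_st_rank -> nat;
  st_mod : 'rV[S]_st_rank -> Prop;
  st_good : good_syzygy st_shift st_mod
}.

Record cover (s : stage) := Cover {
  cv_rank : nat;
  cv_shift : 'I_cv_rank -> nat;
  cv_mx : 'M[S]_(cv_rank, st_rank s);
  cv_graded : graded_mx cv_shift (@st_shift s) cv_mx;
  cv_image : forall v, st_mod v <-> im_mx cv_mx v;
  cv_good : good_syzygy cv_shift (ker_mx cv_mx)
}.

(** Vanishing of H_1 gives generators in degrees at most [n]. By [koszul_nz_up], a class in H_p of
    the new quotient would give one in H_(p+1) of the old. *)
Lemma exists_cover s : inhabited (cover s).
Proof.
case: s => m sh N [gN Nmax nz].
have hiN j v : (n < j)%N -> N v -> prj sh j 0 v = v ->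
    exists2 y : 'I_n -> 'rV[S]_m, forall i, N (y i) & v = \sum_i 'X_i *: y i.
  by move=> nj; apply: (decomp_of_koszul gN Nmax); exact: nz.
have [r [sh' [D [gD hD kD]]]] := minimal_generators gN hiN.
constructor; apply: (@Cover (Stage (And3 gN Nmax nz)) r sh' D gD hD).
split=> // [|p j p0 nj nzp].
  split.
  - by rewrite /ker_mx mul0mx.
  - by move=> u v; rewrite /ker_mx mulmxDl => -> ->; rewrite addr0.
  - by move=> a v; rewrite /ker_mx -scalemxAl => ->; rewrite scaler0.
  - by move=> d k v hv; rewrite /ker_mx -(prj_mul gD) hv prj0.
apply: (nz p.+1 j) => //; apply: (koszul_nz_ext (N := im_mx D)).
  by move=> v; split=> /hD.
by apply: (koszul_nz_up gD) => // p00; rewrite p00 in p0.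
Qed.

Definition chosen_cover s : cover s := epsilon (exists_cover s) (fun _ => True).
Definition next_stage s : stage := Stage (cv_good (chosen_cover s)).

Variable I : S -> Prop.
Notation shI := (fun _ : 'I_1 => 0%N).
Notation idl := (fun v : 'rV[S]_1 => I (v 0 0)).
Hypothesis goodI : good_syzygy shI idl.

Definition stages i := iter i next_stage (Stage goodI).

Lemma exists_resolution : inhabited (min_graded_free_resolution I).
Proof.
constructor.
(* The cover of stage 0 is the augmentation, that of stage i + 1 the differential into F_i. *)
pose C i := chosen_cover (stages i).
apply: (@MinGradedFreeResolution F n I (fun i => cv_rank (C i))
  (fun i => @cv_shift _ (C i)) (fun i => cv_mx (C i.+1)) (cv_mx (C 0%N))).
- move=> k; case: (eqVneq (cv_mx (C 0%N) k 0) 0) => [->|/(cv_graded (c := C 0%N))[e he ->]].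
    exact: dhomog0.
  exact: he.
- by move=> i; exact: (cv_graded (c := C i.+1)).
- move=> p; split=> [Ip|[w <-]].
    have /(cv_image (C 0%N))[w hw] : @st_mod (stages 0) (const_mx p) by rewrite /= mxE.
    by exists w; rewrite hw mxE.
  by apply/(cv_image (C 0%N)); exists w.
- by move=> v; exact: (cv_image (C 1%N) v).
- by move=> i v; exact: (cv_image (C i.+2) v).
(* Minimality: the rows of the differential lie in the previous kernel, which the invariant places
   in the maximal ideal. *)
move=> i k l; have [_ hmax _] := st_good (stages i.+1).
have /hmax/(_ 0 l) : st_mod (row k (cv_mx (C i.+1))).
  by apply/(cv_image (C i.+1)); exists (delta_mx 0 k); rewrite -rowE.
by rewrite mxE.
Qed.

End Existence.

(** * Hochster's formula *)

Section Cochains.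
Variables (F : fieldType) (n : nat).
Implicit Types (v u : 'I_n) (s t W : {set 'I_n}) (a b : {set 'I_n} -> F).
Notation kd1 := (kd (V := F^o) (fun _ : 'I_n => 1)).

Definition cd a s : F := \sum_(v in s) ksgn F v s * a (s :\ v).

(* Reduced cohomology of the complex X in dimension q - 1: cochains are functions
   on all sets, compared only on the faces of X with q elements. *)
Definition cohom_nz (X : pred {set 'I_n}) (q : nat) : Prop :=
  exists a, (forall s, X s -> #|s| = q.+1 -> cd a s = 0) /\
    ~ exists b, forall s, X s -> #|s| = q -> a s = cd b s.

Lemma cdB a b s : cd (fun s => a s - b s) s = cd a s - cd b s.
Proof. by rewrite -sumrB; apply: eq_bigr => v _; rewrite mulrBr. Qed.

Lemma eq_cd a b s : (forall v, v \in s -> a (s :\ v) = b (s :\ v)) -> cd a s = cd b s.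
Proof. by move=> h; apply: eq_bigr => v vs; rewrite h. Qed.

(** The sign needed when a set is replaced by its complement in [W]; see [cd_setD]. *)
Definition wgt W s : F := \prod_(v in s) ksgn F v W.

Lemma wgt_sqr W s : wgt W s * wgt W s = 1.
Proof. by rewrite -big_split big1 //= => v _; rewrite ksgn_sqr. Qed.

Lemma ksgnD v s W : s \subset W -> ksgn F v s * ksgn F v W = ksgn F v (W :\: s).
Proof.
move=> sW; have -> : ksgn F v W = ksgn F v s * ksgn F v (W :\: s).
  rewrite /ksgn -exprD; congr (_ ^+ _).
  rewrite -[LHS](cardsID s); congr (_ + _)%N; apply: eq_card => u; rewrite !inE.
    by case: (boolP (u \in s)) => us; rewrite ?andbF // (subsetP sW _ us) andbT.
  by case: (u \in s); case: (u \in W).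
by rewrite mulrA ksgn_sqr mul1r.
Qed.

(* Complementation in W turns the Koszul differential into the coboundary. *)
Lemma cd_setD W a s : s \subset W ->
    (forall t, ~~ (t \subset W) -> a t = 0) ->
  cd (fun s => wgt W s * a (W :\: s)) s = wgt W s * kd1 a (W :\: s).
Proof.
move=> sW ha; rewrite /kd mulr_sumr.
rewrite (bigID (fun v => v \in W)) /= addrC big1 ?add0r => [|v /andP[_ vW]]; last first.
  by rewrite ha ?scaler0 ?mulr0 // subUset sub1set (negPf vW).
apply: eq_big => [v|v vs].
  rewrite !inE negb_and negbK; case: (boolP (v \in s)) => vs; first by rewrite (subsetP sW).
  by case: (v \in W).
have -> : W :\: (s :\ v) = v |: (W :\: s).
  apply/setP=> u; rewrite !inE; case: eqP => [->|//]; by rewrite (subsetP sW _ vs).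
rewrite -(ksgnD v sW) /GRing.scale /= mulr1.
have -> : wgt W s = ksgn F v W * wgt W (s :\ v) by rewrite /wgt (big_setD1 v vs).
have := ksgn_sqr F v W; set k := ksgn F v W => k2.
transitivity (k * k * (ksgn F v s * (wgt W (s :\ v) * a (v |: W :\: s)))); last by ring.
by rewrite k2 mul1r.
Qed.

(** Transported from [kd_kd] by complementation in the full vertex set. *)
Lemma cd_cd a s : cd (cd a) s = 0.
Proof.
pose a' t := wgt setT (~: t) * a (~: t).
have h (c : {set 'I_n} -> F) r :
    cd (fun s => wgt setT s * c (~: s)) r = wgt setT r * kd1 c (~: r).
  rewrite -setTD -cd_setD ?subsetT // => [|t]; last by rewrite subsetT.
  by apply: eq_cd => v _; rewrite setTD.
have aE t : a t = wgt setT t * a' (~: t).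
  by rewrite /a' setCK mulrA wgt_sqr mul1r.
rewrite (@eq_cd (cd a) (fun s => wgt setT s * kd1 a' (~: s))) => [|v _].
  by rewrite h kd_kd mulr0.
by rewrite -h; apply: eq_cd => u _; exact: aE.
Qed.

End Cochains.

Section Hochster.
Variables (F : fieldType) (n : nat) (Delta : pred {set 'I_n}).
Notation S := {mpoly F[n]}.
Implicit Types (v u : 'I_n) (s t W : {set 'I_n}) (b m : 'X_{1..n}).
Hypothesis Delta_sub : forall s t, s \subset t -> Delta t -> Delta s.
Notation kdX := (kd (fun v => 'X_v : S)).
Notation kd1 := (kd (V := F^o) (fun _ : 'I_n => 1)).

Definition msup m : {set 'I_n} := [set v | m v != 0%N].

(* The Stanley-Reisner ideal of Delta. *)
Definition sr_ideal (p : S) := forall m, Delta (msup m) -> p@_m = 0.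

Notation shI := (fun _ : 'I_1 => 0%N).
Notation idl := (fun v : 'rV[S]_1 => sr_ideal (v 0 0)).

Lemma sr_idealM p q : sr_ideal q -> sr_ideal (p * q).
Proof.
move=> hq m hm; rewrite mcoeffM big1 // => k /eqP mk; rewrite hq ?mulr0 //.
apply: Delta_sub hm; apply/subsetP=> v; rewrite !inE => kv.
by rewrite mk mnmDE; move: kv; lia.
Qed.

Lemma graded_submod_sr : graded_submod shI idl.
Proof.
split.
- by move=> m _; rewrite mxE mcoeff0.
- by move=> u v hu hv m hm; rewrite mxE mcoeffD hu ?hv ?addr0.
- by move=> a v hv; rewrite mxE; exact: sr_idealM.
- by move=> d k v hv m hm; rewrite mxE mcoeff_hcomp hv // if_same.
Qed.

Lemma sr_ideal_max (v : 'rV[S]_1) : Delta set0 -> idl v -> in_max v.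
Proof.
move=> D0 hv i l; rewrite (ord1 i) (ord1 l) hv //.
by rewrite (_ : msup _ = set0) //; apply/setP=> u; rewrite !inE mnm0E.
Qed.

Lemma mcoeff_mcomp (c : {set 'I_n} -> S) t m : (c t)@_m = mcomp c (m + mset t)%MM t.
Proof. by rewrite /mcomp lem_addl addmK. Qed.

Lemma mset_leW t W : (mset t <= mset W)%MM = (t \subset W).
Proof.
rewrite mset_le (_ : [set v | _] = W) //.
by apply/setP=> v; rewrite inE msetE; case: (v \in W).
Qed.

Lemma msetD t W : (mset W - mset t)%MM = mset (W :\: t).
Proof.
by apply/mnmP=> v; rewrite mnmBE !msetE inE; case: (v \in W); case: (v \in t).
Qed.

Lemma msup_mset t : msup (mset t) = t.
Proof. by apply/setP=> v; rewrite inE msetE; case: (v \in t). Qed.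

Lemma mset_msup b : (forall v, b v < 2)%N -> b = mset (msup b).
Proof. by move=> h; apply/mnmP=> v; rewrite msetE inE; move: (h v); case: (b v) => [|[|]]. Qed.

Section Squarefree.
Variables (W : {set 'I_n}).

(** The chain matching the cochain [a] under complementation in [W], extended by zero to sets not
    inside [W]. *)
Definition compl_cochain (a : {set 'I_n} -> F) t : F :=
  if t \subset W then wgt F W (W :\: t) * a (W :\: t) else 0.

Lemma compl_cochain_supp a t : ~~ (t \subset W) -> compl_cochain a t = 0.
Proof. by rewrite /compl_cochain => /negPf->. Qed.

Lemma compl_cochainE a s : s \subset W ->
  wgt F W s * compl_cochain a (W :\: s) = a s.
Proof.
move=> sW; rewrite /compl_cochain subDset subsetUr setDDr setDv set0U (setIidPr sW).
by rewrite mulrA wgt_sqr mul1r.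
Qed.

Lemma cd_compl a s : s \subset W -> cd a s = wgt F W s * kd1 (compl_cochain a) (W :\: s).
Proof.
move=> sW; rewrite -cd_setD //; last exact: compl_cochain_supp.
apply: eq_cd => v _; rewrite compl_cochainE //.
exact: subset_trans (subsetDl _ _) sW.
Qed.

Lemma wgt_inj s (x y : F) : wgt F W s * x = wgt F W s * y -> x = y.
Proof. by move/(congr1 ( *%R (wgt F W s))); rewrite !mulrA wgt_sqr !mul1r. Qed.

End Squarefree.

(** A class that does not bound fails to bound in some multidegree [b]. This [b] must have degree
    [j] and be squarefree, and complementation in its support [W] turns the chain into a cocycle on
    faces of size [j - p]. *)
Lemma hochster_cohom p j : koszul_nz shI idl p j ->
  exists2 W : {set 'I_n}, #|W| = j & (p <= j)%N /\
    cohom_nz F (fun s : {set 'I_n} => (s \subset W) && Delta s) (j - p).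
Proof.
move=> [c [hc cyc nb]]; pose c0 (t : {set 'I_n}) : S := c t 0 0.
have kd00 (d : {set 'I_n} -> 'rV[S]_1) (t : {set 'I_n}) :
    kdX d t 0 0 = kd (V := S^o) (fun v => 'X_v : S) (fun t => d t 0 0) t.
  exact: kd_entry.
have cyc0 b (t : {set 'I_n}) : #|t|.+1 = p -> Delta (msup (b - mset t)%MM) -> kd1 (mcomp c0 b) t = 0.
  move=> tp hD; rewrite -mcomp_kd /mcomp; case: ifP => // _.
  by rewrite -kd00; apply: cyc.
have [b hb] : exists b, ~ exists e : {set 'I_n} -> F^o,
    (forall t : {set 'I_n}, ~~ (mset t <= b)%MM -> e t = 0) /\
    (forall t : {set 'I_n}, #|t| = p -> (mset t <= b)%MM -> ~~ ~~ Delta (msup (b - mset t)%MM) ->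
      mcomp c0 b t = kd1 e t).
  apply: not_all_ex_not => no; case: nb.
  have [d hd] := @boundary_of_mcomp _ _ (fun m => ~~ Delta (msup m)) c0 p no.
  exists (fun t => const_mx (d t)) => t tp m hm.
  rewrite mxE [X in _ + X]mxE kd00 -[RHS](hd t tp m) ?negbK //.
  congr ((_ - _)@__); apply: (eq_kd (V := S^o)) => t' _; by rewrite mxE.
have bj : mdeg b = j.
  apply/eqP/negPn/negP=> ne; case: hb; exists (fun _ => 0); split=> // t tp tb _.
  rewrite kd0 /mcomp tb /c0 -hc mxE mcoeff_hcomp ifN //.
  by rewrite add0n -mdeg_mset -mdegD submK.
(* If [b v] is at least 2, inserting [v] into [t] does not change the support of [b - mset t], so
   toggling [v] makes the component bound. *)
have b1 : b = mset (msup b).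
  apply: mset_msup => v; rewrite ltnNge; apply/negP=> bv; case: hb.
  exists (toggle v (mcomp c0 b)); split.
    move=> t; apply: toggle_supp; last by move: bv; case: (b v).
    by move=> s sb; rewrite /mcomp (negPf sb).
  move=> t tp tb; rewrite negbK => hD.
  pose A (t : {set 'I_n}) := (mset t <= b)%MM && Delta (msup (b - mset t)%MM).
  apply: (toggle_exact (A := A) (p := p)) => //; last by rewrite /A tb.
    move=> s vs; rewrite /A; congr (_ && Delta _).
      by rewrite !mset_le subUset sub1set inE; move: bv; case: (b v).
    apply/setP=> u; rewrite !inE !mnmBE !msetE !inE.
    by case: (eqVneq u v) => [->|//]; rewrite (negPf vs); move: bv; case: (b v) => [|[|]].
  by move=> s sp /andP[_ hs]; exact: cyc0.
pose W := msup b; have Wj : #|W| = j by rewrite -mdeg_mset -b1.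
have pj : (p <= j)%N.
  rewrite leqNgt; apply/negP=> jp; case: hb; exists (fun _ => 0); split=> // t tp.
  by rewrite b1 mset_leW => /subset_leq_card; rewrite tp Wj leqNgt jp.
exists W => //; split=> //; exists (fun s => wgt F W s * mcomp c0 b (W :\: s)).
have suppb (t : {set 'I_n}) : ~~ (t \subset W) -> mcomp c0 b t = 0.
  by rewrite -mset_leW -b1 /mcomp => /negPf->.
have cardW (s : {set 'I_n}) : s \subset W -> #|W :\: s| = (j - #|s|)%N.
  by move=> sW; rewrite cardsD (setIidPr sW) Wj.
split=> [s /andP[sW Ds] sq|[b' hb']].
  rewrite cd_setD // cyc0 ?mulr0 //.
    by rewrite cardW // sq; have := subset_leq_card sW; rewrite Wj sq; lia.
  by rewrite {1}b1 msetD msup_mset setDDr setDv set0U (setIidPr sW).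
case: hb; exists (compl_cochain W b'); split=> [t|t tp].
  by rewrite {1}b1 mset_leW; exact: compl_cochain_supp.
rewrite {1 2}b1 mset_leW msetD msup_mset negbK => tW Dt.
have := hb' (W :\: t); rewrite subsetDl Dt => /(_ isT).
have tE : W :\: (W :\: t) = t by rewrite setDDr setDv set0U (setIidPr tW).
rewrite (cd_compl _ (subsetDl W t)) tE => h; apply: wgt_inj (h _).
by rewrite cardW // tp.
Qed.

(** The complement of the cocycle is placed in the single multidegree [mset W], of degree [j]; cycle
    and boundary conditions are then read there. *)
Lemma cohom_hochster p j W : #|W| = j -> (p <= j)%N ->
  cohom_nz F (fun s : {set 'I_n} => (s \subset W) && Delta s) (j - p) -> koszul_nz shI idl p j.
Proof.
move=> Wj pj [a' [cyc nb]]; pose a := compl_cochain W a'; pose b := mset W.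
have [|c0 hc0] := @exists_mcomp F n j.+1 (fun b' t => if b' == b then a t else 0).
  by move=> b' t; case: eqP => // ->; rewrite mset_leW; exact: compl_cochain_supp.
have {}hc0 b' (t : {set 'I_n}) : mcomp c0 b' t = if b' == b then a t else 0.
  by rewrite hc0; case: eqP => [->|]; rewrite ?if_same // mdeg_mset Wj ltnSn.
have cardW (s : {set 'I_n}) : s \subset W -> #|W :\: s| = (j - #|s|)%N.
  by move=> sW; rewrite cardsD (setIidPr sW) Wj.
have WD (t : {set 'I_n}) : t \subset W -> W :\: (W :\: t) = t.
  by move=> tW; rewrite setDDr setDv set0U (setIidPr tW).
have c0E : (fun t : {set 'I_n} => (const_mx (c0 t) : 'rV[S]_1) 0 0) = c0.
  by apply: functional_extensionality => t; rewrite mxE.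
exists (fun t => const_mx (c0 t)); split.
- move=> t; apply/rowP=> l; rewrite !mxE; apply/mpolyP=> m.
  rewrite mcoeff_hcomp add0n mcoeff_mcomp hc0; case: eqP => // ne; case: eqP => // e.
  by case: ne; rewrite -Wj -(mdeg_mset W) -[mset W]/b -e mdegD mdeg_mset.
- move=> t tp m hm; rewrite kd_entry c0E mcoeff_mcomp mcomp_kd.
  have [e|ne] := eqVneq (m + mset t)%MM b; last first.
    rewrite -[RHS](@kd0 _ _ F^o (fun=> 1) t); apply: (eq_kd (V := F^o)) => t' _.
    by rewrite hc0 (negPf ne).
  have tW : t \subset W by rewrite -mset_leW -/b -e lem_addl.
  have mE : msup m = W :\: t by rewrite -(addmK (mset t) m) e msetD msup_mset.
  apply: (@wgt_inj W (W :\: t)); rewrite mulr0 -[RHS](cyc (W :\: t)) ?(cd_compl _ (subsetDl W t)) //.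
  + rewrite WD //; congr (_ * _); apply: (eq_kd (V := F^o)) => t' _.
    by rewrite hc0 e eqxx.
  + by rewrite -mE hm mE subsetDl.
  + rewrite cardW //; have := subset_leq_card tW; rewrite Wj; lia.
case=> d hd; case: nb; pose d0 (t : {set 'I_n}) : S := d t 0 0.
exists (fun s => wgt F W s * mcomp d0 b (W :\: s)) => s /andP[sW Ds] sq.
have sp : #|W :\: s| = p by rewrite cardW // sq subKn.
rewrite cd_setD // => [|t]; last by rewrite -mset_leW /mcomp => /negPf->.
rewrite -(compl_cochainE a' sW) -/a; congr (_ * _).
have := hd _ sp (mset s); rewrite msup_mset => /(_ Ds).
rewrite mxE [X in _ + X]mxE kd_entry mxE.
rewrite [LHS](mcoeff_mcomp (fun t => c0 t - kd (V := S^o) (fun v => 'X_v : S) d0 t)).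
have -> : (mset s + mset (W :\: s))%MM = b.
  apply/mnmP=> v; rewrite mnmDE !msetE !inE.
  by case: (boolP (v \in s)) => [/(subsetP sW)->|].
rewrite mcompB mcomp_kd => /eqP; rewrite subr_eq0 => /eqP.
by rewrite hc0 eqxx.
Qed.

(** Homology of degree [j] comes from a set of [j] variables, so it vanishes for [j] above [n]. *)
Lemma good_syzygy_sr : Delta set0 -> good_syzygy shI idl.
Proof.
move=> D0; split; [exact: graded_submod_sr | by move=> v; exact: sr_ideal_max |].
move=> p j _ nj /hochster_cohom[W Wj _].
by move: nj; rewrite -Wj ltnNge -[X in (_ <= X)%N]card_ord max_card.
Qed.

End Hochster.

(** * Mayer-Vietoris and change of vertex set *)

Section MayerVietoris.
Variables (F : fieldType) (n : nat).
Implicit Types (s t : {set 'I_n}).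

Lemma cohom_nz_ext (X Y : pred {set 'I_n}) q : X =1 Y ->
  cohom_nz F X q -> cohom_nz F Y q.
Proof.
move=> e [a [h1 h2]]; exists a; split=> [s|[b hb]]; first by rewrite -e; exact: h1.
by apply: h2; exists b => s; rewrite e; exact: hb.
Qed.

Lemma cobounding (X : pred {set 'I_n}) q (a : {set 'I_n} -> F) : ~ cohom_nz F X q ->
  (forall s, X s -> #|s| = q.+1 -> cd a s = 0) ->
  exists b, forall s, X s -> #|s| = q -> a s = cd b s.
Proof. by move=> nz ha; apply: NNPP => h; apply: nz; exists a. Qed.

(** All pieces are glued at once, since any two meet inside [XT]. The local primitives [b k] of the
    cocycle differ from [b k0] on [XT] by cocycles; if these are coboundaries of [c k], subtracting
    them makes the primitives agree. *)
Lemma mayer_vietoris (K : finType) (k0 : K) (X : K -> pred {set 'I_n})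
    (XT Y : pred {set 'I_n}) q :
    (forall k s t, t \subset s -> X k s -> X k t) ->
    (forall k s, X k s -> Y s) ->
    (forall s, Y s -> exists k, X k s) ->
    (forall k s, XT s -> X k s) ->
    (forall k l s, k != l -> X k s -> X l s -> XT s) ->
    cohom_nz F Y q.+1 ->
  (exists k, cohom_nz F (X k) q.+1) \/ cohom_nz F XT q.
Proof.
move=> Xsub XY YX XTX XXT [a [ha nb]]; apply: NNPP => /not_or_and[nX nT].
case: nb; have /dep_choice[b hb] : forall k, exists b : {set 'I_n} -> F, forall s,
    X k s -> #|s| = q.+1 -> a s = cd b s.
  move=> k; apply: cobounding => [nz|s /XY]; last exact: ha.
  by apply: nX; exists k.
have /dep_choice[c hc] : forall k, exists c : {set 'I_n} -> F, forall s,
    XT s -> #|s| = q -> b k s - b k0 s = cd c s.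
  by move=> k; apply: cobounding => // s Ts sq; rewrite cdB -!hb ?subrr //; exact: XTX.
(* A face outside [XT] lies in at most one piece, so the choice made by [pick] is forced. The
   correction is harmless because [cd_cd] kills it. *)
exists (fun s => if XT s then b k0 s else
                 if [pick k | X k s] is Some k then b k s - cd (c k) s else 0).
move=> s Ys sq; have [k Xs] := YX s Ys; rewrite (hb k) // -[LHS]subr0 -(cd_cd (c k) s) -cdB.
apply: eq_cd => v vs; have Xv : X k (s :\ v) by apply: Xsub Xs; exact: subsetDl.
have vq : #|s :\ v| = q by move: sq; rewrite (cardsD1 v s) vs => -[].
case: ifPn => Tv; first by rewrite -hc // opprB addrC subrK.
case: pickP => [l Xl|/(_ k)]; last by rewrite Xv.
by case: (eqVneq k l) => [->//|ne]; case/negP: Tv; exact: XXT ne Xv Xl.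
Qed.

(** After complementation, toggling a vertex of [W] contracts the simplex. If [W] is empty there is
    no face of positive size [q]. *)
Lemma cohom_nz_simplex (W : {set 'I_n}) q : (0 < q)%N ->
  ~ cohom_nz F (fun s => s \subset W) q.
Proof.
move=> q0 [a [ha nb]]; case: nb.
have [->|[v vW]] := set_0Vmem W.
  by exists a => s; rewrite subset0 => /eqP->; rewrite cards0 => e; rewrite -e in q0.
exists (fun s => wgt F W s * toggle v (compl_cochain W a) (W :\: s)) => s sW sq.
have WD t : t \subset W -> W :\: (W :\: t) = t.
  by move=> tW; rewrite setDDr setDv set0U (setIidPr tW).
have cardW (t : {set 'I_n}) : t \subset W -> #|W :\: t| = (#|W| - #|t|)%N.
  by move=> tW; rewrite cardsD (setIidPr tW).
have qW : (q <= #|W|)%N by rewrite -sq subset_leq_card.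
rewrite cd_setD // => [|t tW]; last first.
  rewrite /toggle; case: ifP => // vt; rewrite compl_cochain_supp ?mulr0 //.
  by apply: contra tW => /subsetP h; apply/subsetP=> u ut; case: (eqVneq u v) => [->//|uv];
     apply: h; rewrite !inE uv.
rewrite -(compl_cochainE a sW); congr (_ * _).
apply: (toggle_exact (A := fun t => t \subset W) (p := (#|W| - q)%N)).
- by move=> t vt; rewrite subUset sub1set vW.
- move=> t tq tW; apply: (@wgt_inj _ _ W (W :\: t)).
  have := cd_compl a (subsetDl W t); rewrite WD // => <-; rewrite mulr0 ha ?subsetDl //.
  by rewrite cardW //; move: tq; lia.
- by rewrite cardW // sq.
- exact: subsetDl.
Qed.

End MayerVietoris.

(** * Transport along order-preserving maps of vertices *)

Section Transport.
Variables (F : fieldType) (m n : nat) (f : 'I_m -> 'I_n).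
Hypothesis f_mono : forall i j : 'I_m, (f i < f j)%N = (i < j)%N.

Let f_inj : injective f.
Proof.
move=> i j e; apply: val_inj; apply/eqP; rewrite eqn_leq.
by rewrite [(i <= j)%N]leqNgt [(j <= i)%N]leqNgt -!f_mono e ltnn.
Qed.

(** The signs [ksgn] depend on the order of the vertices, and [f] preserves it. *)
Lemma cd_imset (a : {set 'I_n} -> F) (s : {set 'I_m}) :
  cd (fun s => a (f @: s)) s = cd a (f @: s).
Proof.
rewrite /cd big_imset /=; last by move=> ? ? _ _; exact: f_inj.
apply: eq_bigr => v vs; congr (_ * a _).
  rewrite /ksgn; congr (_ ^+ _); rewrite -(card_imset _ f_inj); apply: eq_card => u.
  rewrite inE; apply/imsetP/andP => [[w]|[/imsetP[w ws ->]]].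
    by rewrite inE => /andP[ws wv] ->; rewrite f_mono imset_f.
  by rewrite f_mono => wv; exists w => //; rewrite inE ws.
apply/setP=> u; rewrite !inE; apply/imsetP/andP => [[w]|[uv /imsetP[w ws e]]].
  by rewrite !inE => /andP[wv ws] ->; rewrite (inj_eq f_inj) wv imset_f.
by exists w => //; rewrite !inE ws andbT; apply: contraNneq uv => <-; rewrite e.
Qed.

Lemma cohom_nz_imset (X : pred {set 'I_n}) q :
    (forall s, X s -> s \subset f @: setT) ->
  cohom_nz F X q -> cohom_nz F (fun s => X (f @: s)) q.
Proof.
move=> Xim [a [ha nb]]; exists (fun s : {set 'I_m} => a (f @: s)).
have pre (s : {set 'I_n}) : X s -> f @: (f @^-1: s) = s.
  move=> /Xim sf; apply/setP=> u; apply/imsetP/idP => [[w]|us].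
    by rewrite inE => ws ->.
  have /imsetP[w _ e] := subsetP sf _ us; exists w => //; by rewrite inE -e.
split=> [s Xs sq|[b hb]]; first by rewrite cd_imset ha // card_imset.
case: nb; exists (fun s : {set 'I_n} => b (f @^-1: s)) => s Xs sq.
have -> : a s = cd b (f @^-1: s).
  by rewrite -[in LHS](pre s Xs) hb ?pre // -(card_imset _ f_inj) pre.
rewrite -[in RHS](pre s Xs) -cd_imset; apply: eq_cd => v _; congr (b _).
by apply/setP=> u; rewrite !inE mem_imset // !inE.
Qed.

End Transport.

(** * Regularity of graphs *)

Section EnumSub.
Variables (T : finType) (A : {set T}).

(** The enumeration of the subtype is the enumeration of [T] filtered by [A], hence increasing in
    the ranks of [T]. *)
Lemma enum_rank_val_mono (i j : 'I_#|{: {x : T | x \in A}}|) :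
  (enum_rank (val (enum_val i)) < enum_rank (val (enum_val j)))%N = (i < j)%N.
Proof.
have valE : map val (enum {: {x : T | x \in A}}) = enum A.
  rewrite enumT (_ : Finite.enum _ = pmap insub (Finite.enum T)); last by rewrite {1}Finite.enum.unlock.
  rewrite [LHS]pmap_filter; last exact: insubK.
  by apply: eq_filter => x; exact: isSome_insub.
pose x0 := val (enum_val i); pose r (x y : T) := (enum_rank x < enum_rank y)%N.
have r_tr : transitive r by move=> y x z; exact: ltn_trans.
have srt : sorted r (enum A).
  rewrite [enum A](_ : _ = filter (mem A) (enum T)); last by rewrite enumT.
  apply: (sorted_filter r_tr).
  have -> : r = relpre (fun x : T => enum_rank x : nat) ltn by [].
  rewrite -sorted_map (_ : map _ _ = iota 0 #|T|) ?iota_ltn_sorted //.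
  apply: (@eq_from_nth _ 0%N) => [|k]; rewrite size_map ?size_iota ?cardE // => kT.
  have kT' : (k < #|T|)%N by rewrite cardE.
  rewrite (nth_map x0) // nth_iota ?add0n // -[k]/(nat_of_ord (Ordinal kT')).
  by rewrite -enum_val_nth enum_valK.
have homo (k l : 'I_#|{: {x : T | x \in A}}|) : (k < l)%N ->
    (enum_rank (val (enum_val k)) < enum_rank (val (enum_val l)))%N.
  have szE : size (enum A) = #|{: {x : T | x \in A}}| by rewrite [RHS]cardE -[in RHS](size_map val) valE.
  have vE (u : 'I_#|{: {x : T | x \in A}}|) : val (enum_val u) = nth x0 (enum A) u.
    have uE : (u < size (enum {: {x : T | x \in A}}))%N by rewrite -cardE.
    rewrite -valE (nth_map (enum_val i) x0 _ uE); congr val; exact: enum_val_nth.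
  by move=> kl; rewrite !vE; apply: (sorted_ltn_nth r_tr x0 srt); rewrite ?inE ?szE.
apply/idP/idP => [h|]; last exact: homo.
rewrite ltnNge leq_eqVlt; apply/negP=> /orP[/eqP/val_inj ji|/homo ji].
  by rewrite ji ltnn in h.
by rewrite ltnNge ltnW in h.
Qed.

End EnumSub.

Section Graph.
Variables (F : fieldType) (G : sgraph).
Notation n := #|G|.
Notation S := {mpoly F[n]}.

Implicit Types (s t W : {set 'I_n}) (i j : 'I_n).

Definition clq (s : {set 'I_n}) : bool :=
  [forall i in s, forall j in s, (i != j) ==> edge (enum_val i) (enum_val j)].

Lemma clqP s : reflect
  (forall i j, i \in s -> j \in s -> i != j -> edge (enum_val i) (enum_val j)) (clq s).
Proof.
apply: (iffP forall_inP) => [h i j si sj ij|h i si].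
  by have /forall_inP/(_ j sj)/implyP := h i si; exact.
by apply/forall_inP=> j sj; apply/implyP; exact: h.
Qed.

Lemma clq_sub s t : s \subset t -> clq t -> clq s.
Proof. by move=> /subsetP st /clqP h; apply/clqP=> i j /st ti /st; exact: h. Qed.

Lemma clq0 : clq set0.
Proof. by apply/clqP=> i j; rewrite inE. Qed.

Notation idl := (@nonedge_ideal F G).

Lemma nonedge_idealD p q : idl p -> idl q -> idl (p + q).
Proof.
move=> [c ->] [d ->]; exists (fun x y => c x y + d x y).
rewrite -big_split; apply: eq_bigr => x _; rewrite -big_split; apply: eq_bigr => y _.
by rewrite mulrDl.
Qed.

Lemma nonedge_ideal_gen x y q : x != y -> ~~ edge x y ->
  idl (q * ('X_(enum_rank x) * 'X_(enum_rank y))).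
Proof.
move=> xy nxy; exists (fun x' y' => if (x' == x) && (y' == y) then q else 0).
rewrite (bigD1 x) //= [X in _ + X]big1 ?addr0; last first.
  by move=> x' /negPf ne; rewrite big1 // => y' _; rewrite ne mul0r.
rewrite (bigD1 y) /=; last by rewrite xy nxy.
rewrite !eqxx big1 ?addr0 // => y' /andP[_ /negPf ne].
by rewrite ne andbF mul0r.
Qed.

(** A monomial whose support is not a clique is divisible by a generator x_i x_j, while a multiple
    of a generator has no monomial supported on a clique. *)
Lemma nonedge_ideal_sr p : idl p <-> sr_ideal clq p.
Proof.
split=> [[c ->] m hm|hp].
  rewrite raddf_sum big1 // => x _; rewrite raddf_sum big1 // => y /andP[xy nxy].
  apply: (sr_idealM clq_sub) hm => {}m hm.
  rewrite -mpolyXD mcoeffX; case: eqP => // mE; move: nxy.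
  have := clqP _ hm (enum_rank x) (enum_rank y).
  rewrite /msup !inE -mE !mnmDE !mnm1E !eqxx !enum_rankK (inj_eq enum_rank_inj).
  by rewrite (inj_eq enum_rank_inj) addn1 => ->.
rewrite (mpolyE p) big_seq; elim/big_rec: _ => [|m q mp].
  exists (fun _ _ => 0); rewrite big1 // => x _; rewrite big1 // => y _; by rewrite mul0r.
apply: nonedge_idealD.
have : ~~ clq (msup m).
  by apply: contraTN mp => hm; rewrite mcoeff_msupp negbK hp.
case/forall_inPn => i; rewrite inE => mi /forall_inPn[j]; rewrite inE => mj.
rewrite negb_imply => /andP[ij nij].
have -> : p@_m *: 'X_[m] = p@_m *: 'X_[m - U_(i) - U_(j)] *
    ('X_(enum_rank (enum_val i)) * 'X_(enum_rank (enum_val j))).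
  rewrite !enum_valK -scalerAl -!mpolyXD; congr (_ *: 'X_[_]).
  apply/mnmP=> k; rewrite !mnmDE !mnmBE !mnm1E.
  case: (eqVneq i k) => [ik|_]; case: (eqVneq j k) => [jk|_] /=.
  - by rewrite ik jk eqxx in ij.
  - by move: mi; rewrite ik; case: (m k) => // c _; rewrite subn0 addn0 subn1 addn1.
  - by move: mj; rewrite jk; case: (m k) => // c _; rewrite subn0 add0n subn1 addn1.
  - by rewrite !subn0 !addn0.
by apply: nonedge_ideal_gen => //; rewrite (inj_eq enum_val_inj).
Qed.

Notation shI := (fun _ : 'I_1 => 0%N).
Notation Cl W := (fun s : {set 'I_n} => (s \subset W) && clq s).

(** Hochster's formula for the clique complex. As [graded_betti] is chosen by [epsilon], a minimal
    resolution has to be produced first. *)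
Lemma betti_cohom (i j : nat) : graded_betti idl i j <> 0%N <->
  exists2 W : {set 'I_n}, #|W| = j & (i < j)%N /\ cohom_nz F (Cl W) (j - i.+1).
Proof.
have eN (v : 'rV[S]_1) : sr_ideal clq (v 0 0) <-> idl (v 0 0).
  by split=> /nonedge_ideal_sr.
have [R0] : inhabited (min_graded_free_resolution idl).
  apply: exists_resolution; have [gN mN nz] := good_syzygy_sr F clq_sub clq0.
  have [N0 ND NZ Np] := gN.
  split=> [|v /eN|p j' p0 nj h].
  - by split=> [|u v /eN hu /eN hv|a v /eN hv|d k v /eN hv]; apply/eN; auto.
  - exact: mN.
  - by apply: (nz p j' p0 nj); apply: koszul_nz_ext h => v; split=> /eN.
have Imax p : idl p -> p@_0%MM = 0.
  move=> /nonedge_ideal_sr hp; apply: hp; apply: clq_sub clq0.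
  by apply/subsetP=> v; rewrite inE mnm0E.
have [R ->] : exists R : min_graded_free_resolution idl,
    graded_betti idl i j = #|[set k : 'I_(rk R i) | shift k == j]|.
  exact: (epsilon_spec (inhabits 0%N)
    (fun b => exists R : min_graded_free_resolution idl,
       b = #|[set k : 'I_(rk R i) | shift k == j]|) (ex_intro _ _ (ex_intro _ R0 erefl))).
rewrite (betti_koszul R Imax); split=> [h|[W Wj [ij h]]].
  apply: hochster_cohom; apply: koszul_nz_ext h => v; by split=> /eN.
have := cohom_hochster Wj ij h; apply: koszul_nz_ext => v; exact: eN.
Qed.

(** If [W] has at most [q] elements, either it is a clique and the complex is a simplex, or it
    contains no clique of size [q]. *)
Lemma cohom_nz_lt (W : {set 'I_n}) q : (0 < q)%N -> cohom_nz F (Cl W) q -> (q < #|W|)%N.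
Proof.
move=> q0 nz; rewrite ltnNge; apply/negP=> Wq.
have [cW|nW] := boolP (clq W).
  apply: (@cohom_nz_simplex F _ W q q0); apply: cohom_nz_ext nz => s.
  by case: (boolP (s \subset W)) => // sW; rewrite (clq_sub sW cW).
have [a [_ nb]] := nz; case: nb; exists (fun _ => 0) => s /andP[sW cs] sq.
have sE : s = W by apply/eqP; rewrite eqEcard sW sq.
by rewrite -sE cs in nW.
Qed.

Definition betti_row r := exists i : nat, graded_betti idl i (i + r) <> 0%N.

Lemma betti_rowE r : (1 < r)%N ->
  betti_row r <-> exists W : {set 'I_n}, cohom_nz F (Cl W) r.-1.
Proof.
case: r => [|[|q]] // _; split=> [[i /betti_cohom[W _ [_ h]]]|[W h]].
  by exists W; move: h; rewrite addnS subSS addKn.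
have Wq := cohom_nz_lt (ltn0Sn q) h.
(* The index [i] solves [i + r = #|W|] for [r = q.+2]; by [Wq] the subtraction is not truncated. *)
exists (#|W| - q.+2)%N; apply/betti_cohom; exists W; first by rewrite subnK.
split; first by rewrite -addSnnS leq_addr.
by rewrite addnS subSS addKn.
Qed.

(** Two non-adjacent vertices span two isolated points. The indicator of one of them is a cocycle,
    whereas a coboundary takes the same value [b set0] on both. *)
Lemma betti_row2 : ~~ complete G -> betti_row 2.
Proof.
case/forallPn => x /forallPn[y]; rewrite negb_imply => /andP[xy nxy].
apply/betti_rowE => //=; exists [set enum_rank x; enum_rank y].
have rxy : enum_rank x != enum_rank y by rewrite (inj_eq enum_rank_inj).
have sgn1 i : ksgn F i [set i] = 1.
  rewrite /ksgn (_ : [set _ in _ | _] = set0) ?cards0 //.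
  by apply/setP=> u; rewrite !inE; case: eqP => //= ->; rewrite ltnn.
exists (fun s => (enum_rank x \in s)%:R); split=> [s /andP[sW cs] s2|[b hb]].
  have sE : s = [set enum_rank x; enum_rank y].
    by apply/eqP; rewrite eqEcard sW s2 cards2 rxy.
  have /clqP/(_ (enum_rank x) (enum_rank y)) := cs.
  by rewrite sE !inE !eqxx orbT !enum_rankK (negPf nxy) => /(_ isT isT rxy).
have c1 i : i \in [set enum_rank x; enum_rank y] ->
    (enum_rank x \in [set i])%:R = b set0 :> F.
  move=> hi; rewrite hb ?cards1 ?sub1set ?hi //=.
    by rewrite /cd big_set1 sgn1 mul1r setDv.
  by apply/clqP=> u v; rewrite !inE => /eqP-> /eqP->; rewrite eqxx.
have := c1 (enum_rank x); rewrite !inE eqxx => /(_ isT) e1.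
have := c1 (enum_rank y); rewrite !inE eqxx orbT (negPf rxy) -e1 => /(_ isT) /eqP.
by rewrite eq_sym oner_eq0.
Qed.

(** Nonzero rows exist by [betti_row2] and are bounded by the number of vertices, as [i + r] is the
    size of some [W]. So the maximum exists and [epsilon] returns it. *)
Lemma reg_is_max : ~~ complete G -> is_max betti_row (reg F G).
Proof.
move=> nc; rewrite /reg (negPf nc); apply: epsilon_spec.
have bnd r : betti_row r -> (r <= n)%N.
  move=> [i /betti_cohom[W Wj _]]; rewrite (leq_trans (leq_addl i r)) // -Wj.
  by rewrite -[X in (_ <= X)%N]card_ord max_card.
have [b hb bmin] := @least_nat (fun b => forall r, betti_row r -> (r <= b)%N) n bnd.
exists b; split=> //; apply: NNPP => nb.
have b2 := hb _ (betti_row2 nc).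
have /bmin : forall r, betti_row r -> (r <= b.-1)%N; last by lia.
move=> r hr; have := hb r hr; rewrite leq_eqVlt => /orP[/eqP e|]; last by lia.
by case: nb; rewrite -e.
Qed.

Lemma reg_gt0 : (0 < reg F G)%N.
Proof.
have [c|nc] := boolP (complete G); first by rewrite /reg c.
have [_ h] := reg_is_max nc; exact: leq_trans (h _ (betti_row2 nc)).
Qed.

(** For a complete graph the complex is a simplex, with cohomology at most for [q = 0], in
    accordance with the convention that the regularity is 1. *)
Lemma cohom_nz_reg (W : {set 'I_n}) q : cohom_nz F (Cl W) q -> (q < reg F G)%N.
Proof.
case: q => [|q] h; first exact: reg_gt0.
have [c|nc] := boolP (complete G).
  case: (@cohom_nz_simplex F _ W q.+1) => //; apply: cohom_nz_ext h => s.
  rewrite (_ : clq s) ?andbT //; apply/clqP=> i j _ _ ij.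
  have /forallP/(_ (enum_val i))/forallP/(_ (enum_val j))/implyP := c; apply.
  by rewrite (inj_eq enum_val_inj).
have [_] := reg_is_max nc; apply; apply/betti_rowE => //; by exists W.
Qed.

Lemma reg_cohom_nz : ~~ complete G ->
  exists (W : {set 'I_n}) q, reg F G = q.+2 /\ cohom_nz F (Cl W) q.+1.
Proof.
move=> nc; have [h1 h2] := reg_is_max nc; have := h2 _ (betti_row2 nc).
case: (reg F G) h1 => [|[|q]] // /betti_rowE[] // W hW _; by exists W, q.
Qed.

End Graph.

(** * Induced subgraphs *)

Section Induced.
Variables (F : fieldType) (G : sgraph).
Implicit Types (A : {set G}) (s t W : {set 'I_#|G|}).

Definition ranks A : {set 'I_#|G|} := [set i | enum_val i \in A].

(** The cliques of [G] inside [A] are the images of those of [induced A] under the increasing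
    inclusion [f] of indices. *)
Lemma cohom_nz_induced A W q :
  cohom_nz F (fun s => (s \subset W :&: ranks A) && clq s) q ->
  (q < reg F (induced A))%N.
Proof.
pose f (i : 'I_#|induced A|) : 'I_#|G| := enum_rank (val (enum_val i)).
have f_mono i j : (f i < f j)%N = (i < j)%N by exact: enum_rank_val_mono.
move=> nz; apply: (@cohom_nz_reg F (induced A) (f @^-1: W)).
apply: cohom_nz_ext (cohom_nz_imset f_mono (X := fun s => (s \subset W :&: ranks A) && clq s) _ nz).
  move=> s; congr (_ && _).
    apply/subsetP/subsetP => h u.
      by move=> us; have := h (f u) (imset_f f us); rewrite !inE => /andP[].
    case/imsetP => w ws ->; have := h w ws; rewrite !inE /f enum_rankK => -> /=.
    exact: valP (enum_val w).
  have f_inj : injective f by move=> i j /enum_rank_inj/val_inj/enum_val_inj.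
  have eE i j : edge (enum_val (f i)) (enum_val (f j)) = edge (enum_val i) (enum_val j).
    by rewrite /f !enum_rankK.
  apply/clqP/clqP => h i j.
    by move=> si sj ij; rewrite -eE; apply: h; rewrite ?imset_f // (inj_eq f_inj).
  case/imsetP => i' si -> /imsetP[j' sj ->]; rewrite (inj_eq f_inj) eE; exact: h.
move=> s /andP[/subsetP sW _]; apply/subsetP=> u /sW; rewrite !inE => /andP[_ uA].
apply/imsetP; exists (enum_rank (Sub (enum_val u) uA : induced A)) => //.
by rewrite /f enum_rankK SubK enum_valK.
Qed.

Lemma connect_equivalence_rel : equivalence_rel (connect (@edge G)).
Proof.
have sym : ssrbool.symmetric (connect (@edge G)) by apply: sym_connect_sym; exact: edge_sym.
by apply/equivalence_relP; split; [exact: connect0 | exact: left_trans sym (@connect_trans _ _)].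
Qed.

End Induced.

(* The cover of the clique complex by the pieces G_i *)
Local Close Scope ring_scope.

Theorem theorem1p2 (F : fieldType) (charF0 : [pchar F]%R =i pred0)
    (G : sgraph) (T : {set G}) (disc : disconnected (induced (~: T))) :
  reg F G <=
    maxn (\max_(C in components (induced (~: T)))
            reg F (induced ([set val x | x in C] :|: T)))
         (reg F (induced T)).+1.
Proof.
(* A complete [G] has regularity 1, below reg(T) + 1. Otherwise [W] carries a class on cliques of
   size q + 1 with reg(G) = q + 2. *)
have [c|/(reg_cohom_nz F)[W [q [-> nz]]]] := boolP (complete G).
  rewrite /reg c leq_max; apply/orP; right.
  by [].
set P := components _.
pose H := induced (~: T).
have eqH : {in [set: H] & &, equivalence_rel (connect (@edge H))}.
  by move=> x y z _ _ _; apply: connect_equivalence_rel.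
have partP : partition P [set: H] := equivalence_partitionP eqH.
have [covP tiP P0] := and3P partP.
pose A (C : {set H}) : {set G} := [set val x | x in C] :|: T.
pose K := {C : {set H} | C \in P}.
have [k0 _] : exists k0 : K, true.
  by move: disc; rewrite /disconnected => /ltnW/card_gt0P[C hC]; exists (Sub C hC : K).
pose X (k : K) (s : {set 'I_#|G|}) := (s \subset W :&: ranks (A (val k))) && clq s.
pose XT (s : {set 'I_#|G|}) := (s \subset W :&: ranks T) && clq s.
have TA C : T \subset A C by exact: subsetUr.
have ranksS (A1 A2 : {set G}) : A1 \subset A2 -> ranks A1 \subset ranks A2.
  by move=> /subsetP h; apply/subsetP=> i; rewrite !inE; exact: h.
have memA (x : H) C : C \in P -> (val x \in A C) = (x \in C).
  move=> CP; rewrite inE; have := valP x; rewrite inE => /negPf->; rewrite orbF.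
  by rewrite mem_imset //; exact: val_inj.
case: (@mayer_vietoris F _ K k0 X XT (fun s => (s \subset W) && clq s) q _ _ _ _ _ nz).
- by move=> k s t ts /andP[sW cs]; rewrite /X (subset_trans ts sW) (clq_sub ts cs).
- by move=> k s /andP[]; rewrite subsetI => /andP[-> _] ->.
(* A clique inside [T] lies in every piece. Otherwise fix a vertex of it outside [T]: the others
   outside [T] are adjacent to it, hence in the same component. *)
- move=> s /andP[sW cs].
  have [/subsetP sT|/subsetPn[i si iT]] := boolP (s \subset ranks T).
    exists k0; rewrite /X cs andbT subsetI sW.
    by apply/subsetP=> i /sT; rewrite !inE => ->; rewrite orbT.
  have iT' : enum_val i \in ~: T by move: iT; rewrite !inE.
  pose x : H := Sub (enum_val i) iT'.
  have xP : pblock P x \in P by rewrite pblock_mem // (eqP covP) inE.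
  exists (Sub (pblock P x) xP : K); rewrite /X cs andbT subsetI sW SubK.
  apply/subsetP=> j sj; rewrite inE.
  have [jT|jT] := boolP (enum_val j \in T); first exact: (subsetP (TA _)).
  have jT' : enum_val j \in ~: T by rewrite inE.
  have -> : enum_val j = val (Sub (enum_val j) jT' : H) by rewrite SubK.
  rewrite memA // pblock_equivalence_partition ?inE //.
  have [ij|ij] := eqVneq i j; last first.
    by apply: connect1; rewrite /= /induced_edge !SubK; exact: (clqP _ cs).
  by rewrite (_ : Sub _ _ = x) ?connect0 //; apply: val_inj; rewrite !SubK ij.
- by move=> k s /andP[sW cs]; rewrite /X cs andbT (subset_trans sW) // setIS // ranksS.
(* A vertex outside [T] common to two pieces would lie in two distinct blocks of the partition into
   components. *)
- move=> k l s kl /andP[sk cs] /andP[sl _]; rewrite /XT cs andbT.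
  apply/subsetP=> i si; have := subsetP sk _ si; have := subsetP sl _ si.
  rewrite 2!in_setI => /andP[iW]; rewrite in_set => il /andP[_]; rewrite in_set => ik.
  rewrite in_setI iW in_set; apply/negPn/negP=> iT.
  have iT' : enum_val i \in ~: T by rewrite inE.
  pose x : H := Sub (enum_val i) iT'.
  have xl : x \in val l by rewrite -(memA x _ (valP l)) SubK.
  have xk : x \in val k by rewrite -(memA x _ (valP k)) SubK.
  case/negP: kl; apply/eqP; apply: val_inj.
  by rewrite -(def_pblock tiP (valP k) xk) (def_pblock tiP (valP l) xl).
(* A class for q + 1 on a piece gives q + 2 <= reg(G_k); a class for q on [T], in the last case,
   gives q + 2 <= reg(T) + 1. *)
- move=> [k /cohom_nz_induced hk]; rewrite leq_max; apply/orP; left.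
  apply: leq_trans hk _.
  exact: (@leq_bigmax_cond _ (fun C => C \in P) (fun C => reg F (induced (A C))) _ (valP k)).
- by move/cohom_nz_induced => hT; rewrite leq_max ltnS hT orbT.
Qed.
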